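(* Let $\mathbf{T}\subseteq\mathbb{N}^2$ be any tree fractal and let $c\in\mathbb{Z}^+$. Then there is no tile assembly system (at any temperature $\tau\in\mathbb{Z}^+$) that strictly self-assembles the $c$-scaling $\mathbf{T}^c$.
   Context: Discrete self-similar fractals: for $g\in\mathbb{N}$ write $\mathbb{N}_g=\{0,\dots,g-1\}$; for $A,B\subseteq\mathbb{N}^2$ and $k\in\mathbb{N}$, $A+kB=\{\vec m+k\vec n : \vec m\in A,\vec n\in B\}$. Let $1<g\in\mathbb{N}$. A set $\mathbf{X}\subset\mathbb{N}^2$ is a $g$-discrete self-similar fractal ($g$-dssf) if there is a set $G$ with $\{(0,0)\}\subsetneq G\subsetneq\mathbb{N}_g^2$ having at least one point in every row and every column of $\mathbb{N}_g^2$ such that $\mathbf{X}=\bigcup_{i\ge1}X_i$, where $X_1=G$ and $X_{i+1}=X_i+g^iG$; $G$ is the generator. The full grid graph of $V\subseteq\mathbb{Z}^2$ has vertex set $V$ and an edge between $\vec x,\vec y\in V$ iff $\|\vec x-\vec y\|=1$. A tree fractal is a $g$-dssf (for some $g>1$) whose full grid graph is a tree (connected and acyclic). For $X\subseteq\mathbb{Z}^2$ and $c\in\mathbb{Z}^+$, the $c$-scaling is $X^c=\{(x,y)\in\mathbb{Z}^2 : (\lfloor x/c\rfloor,\lfloor y/c\rfloor)\in X\}$. Abstract Tile Assembly Model (aTAM): A glue is a pair (label in $\Sigma^*$, strength in $\mathbb{N}$). A tile type is a 4-tuple of glues, one for each side (N, E, S, W) of a unit square; a tile set $T$ is a finite set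 of tile types (with unlimited copies). A configuration is a partial function $\alpha:\mathbb{Z}^2\dashrightarrow T$. Two tiles at adjacent positions interact if the glues on their abutting sides are equal in label and strength and have positive strength; the binding graph of $\alpha$ has vertex set $\mathrm{dom}\,\alpha$ with edges between interacting tiles, weighted by glue strength. An assembly is a configuration with nonempty domain whose domain has connected full grid graph. Given $\tau\in\mathbb{Z}^+$, $\alpha$ is $\tau$-stable if every cut of its binding graph has total weight at least $\tau$. $\alpha\sqsubseteq\beta$ means $\mathrm{dom}\,\alpha\subseteq\mathrm{dom}\,\beta$ and $\alpha,\beta$ agree on $\mathrm{dom}\,\alpha$. A tile assembly system (TAS) is $\mathcal{T}=(T,\sigma,\tau)$ with $T$ a tile set, $\sigma$ a finite $\tau$-stable seed assembly, and temperature $\tau\in\mathbb{Z}^+$. For $\tau$-stable $\alpha,\beta$, $\alpha\to_1\beta$ if $\alpha\sqsubseteq\beta$ and $|\mathrm{dom}\,\beta\setminus\mathrm{dom}\,\alpha|=1$. An assembly sequence is a finite or infinite sequence $\alpha_0,\alpha_1,\dots$ with $\alpha_{i-1}\to_1\alpha_i$; its result is the limit (union). An assembly is producible if it is the result of an assembly sequence starting from $\sigma$; it is terminal if it is $\tau$-stable and no tile can be added to it to yield a $\tau$-stable assembly. $\mathcal{T}$ strictly self-assembles $X\subseteq\mathbb{Z}^2$ if every producible terminal assembly $\alpha$ satisfies $\mathrm{dom}\,\alpha=X$. *)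

(* Defs.v *)
From Stdlib Require Import ZArith List Arith Bool.
Import ListNotations.
Open Scope Z_scope.

Definition point := (Z * Z)%type.

Definition adjacent (p q : point) : Prop :=
  (Z.abs (fst p - fst q) + Z.abs (snd p - snd q) = 1).

Fixpoint grid_path (V : point -> Prop) (x : point) (l : list point) (y : point) : Prop :=
  match l with
  | [] => x = y
  | z :: l' => adjacent x z /\ V z /\ grid_path V z l' y
  end.

Definition grid_connected (V : point -> Prop) : Prop :=
  forall x y, V x -> V y -> exists l, grid_path V x l y.

Definition grid_has_cycle (V : point -> Prop) : Prop :=
  exists (v0 : point) (l : list point),
    NoDup (v0 :: l) /\ (2 <= length l)%nat /\ V v0 /\
    grid_path V v0 l (last l v0) /\ adjacent (last l v0) v0.

Definition grid_tree (V : point -> Prop) : Prop :=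
  (exists p, V p) /\ grid_connected V /\ ~ grid_has_cycle V.

Definition is_generator (g : nat) (G : nat * nat -> Prop) : Prop :=
  (forall p, G p -> (fst p < g)%nat /\ (snd p < g)%nat) /\
  G (0%nat, 0%nat) /\
  (exists p, G p /\ p <> (0%nat, 0%nat)) /\
  (exists p, (fst p < g)%nat /\ (snd p < g)%nat /\ ~ G p) /\
  (forall y, (y < g)%nat -> exists x, G (x, y)) /\
  (forall x, (x < g)%nat -> exists y, G (x, y)).

(* Xs g G k = X_{k+1}:  X_1 = G,  X_{i+1} = X_i + g^i G *)
Fixpoint Xs (g : nat) (G : nat * nat -> Prop) (k : nat) : nat * nat -> Prop :=
  match k with
  | O => G
  | S k' => fun p => exists m n, Xs g G k' m /\ G n /\
              p = (fst m + g ^ k * fst n, snd m + g ^ k * snd n)%nat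
  end.

Definition is_dssf (g : nat) (X : nat * nat -> Prop) : Prop :=
  exists G, is_generator g G /\ forall p, X p <-> exists k, Xs g G k p.

Definition inZ (X : nat * nat -> Prop) : point -> Prop :=
  fun p => 0 <= fst p /\ 0 <= snd p /\ X (Z.to_nat (fst p), Z.to_nat (snd p)).

Definition tree_fractal (X : nat * nat -> Prop) : Prop :=
  (exists g, (1 < g)%nat /\ is_dssf g X) /\ grid_tree (inZ X).

(* c-scaling (Z.div is floor division) *)
Definition scaling (c : Z) (X : point -> Prop) : point -> Prop :=
  fun p => X (fst p / c, snd p / c).

(* glue: (label in Sigma^*, strength) ; Sigma = nat *)
Definition glue := (list nat * nat)%type.

Record tile := mkTile { tN : glue; tE : glue; tS : glue; tW : glue }.

Definition glue_eq_dec : forall a b : glue, {a = b} + {a <> b}.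
Proof. decide equality; [apply Nat.eq_dec | apply list_eq_dec, Nat.eq_dec]. Defined.

Definition glue_match (a b : glue) : nat :=
  if glue_eq_dec a b then snd a else 0%nat.

Definition config := point -> option tile.

Definition dom (a : config) (p : point) : Prop := a p <> None.

Definition over (T : list tile) (a : config) : Prop :=
  forall p t, a p = Some t -> In t T.

(* weight of the edge between p and q in the binding graph (0 = no edge) *)
Definition weight (a : config) (p q : point) : nat :=
  match a p, a q with
  | Some t, Some u =>
      let (x, y) := p in let (x', y') := q in
      if (x' =? x + 1) && (y' =? y) then glue_match (tE t) (tW u)
      else if (x' =? x - 1) && (y' =? y) then glue_match (tW t) (tE u)
      else if (x' =? x) && (y' =? y + 1) then glue_match (tN t) (tS u)
      else if (x' =? x) && (y' =? y - 1) then glue_match (tS t) (tN u)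
      else 0%nat
  | _, _ => 0%nat
  end.

Definition assembly (a : config) : Prop :=
  (exists p, dom a p) /\ grid_connected (dom a).

(* every cut (A, dom a \ A) of the binding graph, with both sides nonempty,
   has total weight >= tau; a (possibly infinite) sum of natural numbers is
   >= tau iff some finite subfamily of its terms sums to >= tau. *)
Definition stable (tau : nat) (a : config) : Prop :=
  forall A : point -> Prop,
    (exists p, dom a p /\ A p) -> (exists q, dom a q /\ ~ A q) ->
    exists l : list (point * point),
      NoDup l /\
      (forall e, In e l -> dom a (fst e) /\ A (fst e) /\ dom a (snd e) /\ ~ A (snd e)) /\
      (tau <= fold_right plus 0%nat (map (fun e => weight a (fst e) (snd e)) l))%nat.

Definition step1 (a b : config) : Prop :=
  (forall p t, a p = Some t -> b p = Some t) /\
  exists p, a p = None /\ b p <> None /\ forall q, q <> p -> b q = a q.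

Definition finite_config (a : config) : Prop :=
  exists l : list point, forall p, dom a p -> In p l.

Definition valid_TAS (T : list tile) (sigma : config) (tau : nat) : Prop :=
  (1 <= tau)%nat /\ assembly sigma /\ over T sigma /\ finite_config sigma /\
  stable tau sigma.

Definition in_range (len : option nat) (i : nat) : Prop :=
  match len with None => True | Some n => (i <= n)%nat end.

(* assembly sequence alpha_0, alpha_1, ... (of length n+1 if len = Some n,
   infinite if len = None) starting from sigma *)
Definition assembly_seq (T : list tile) (sigma : config) (tau : nat)
    (s : nat -> config) (len : option nat) : Prop :=
  (forall p, s O p = sigma p) /\
  (forall i, in_range len i -> assembly (s i) /\ over T (s i) /\ stable tau (s i)) /\
  (forall i, in_range len (S i) -> step1 (s i) (s (S i))).

Definition seq_result (s : nat -> config) (len : option nat) (b : config) : Prop :=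
  forall p t, b p = Some t <-> exists i, in_range len i /\ s i p = Some t.

Definition producible (T : list tile) (sigma : config) (tau : nat) (b : config) : Prop :=
  exists s len, assembly_seq T sigma tau s len /\ seq_result s len b.

Definition add_tile (a : config) (p : point) (t : tile) : config :=
  fun q => if (fst q =? fst p) && (snd q =? snd p) then Some t else a q.

Definition terminal (T : list tile) (tau : nat) (b : config) : Prop :=
  stable tau b /\
  ~ exists p t, In t T /\ b p = None /\
      assembly (add_tile b p t) /\ stable tau (add_tile b p t).

Definition strictly_self_assembles (T : list tile) (sigma : config) (tau : nat)
    (X : point -> Prop) : Prop :=
  forall a, producible T sigma tau a -> terminal T tau a ->
    forall p, dom a p <-> X p.

(* Main.v *)
Require Import Defs.
From Stdlib Require Import ZArith List Arith.
From Stdlib Require Import Bool Lia Classical ClassicalEpsilon FunctionalExtensionality Cantor.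
Import ListNotations.

(** Orient each edge of the tree away from the origin; the part of the tree beyond an edge
    [p -> q] is the cone of that edge. In the scaled shape a cone is attached to the rest
    through the two blocks [p] and [q] only. There are finitely many movies (tiles and order
    of arrival in these two blocks), and if two cones away from the seed have translated
    movies, then the assembly inside one can be replayed inside the other; no tile may leave
    the shape, so the two cones are translates of each other. Thus, if the shape
    self-assembled, the tree would have finitely many cones up to translation.

    This contradicts growth. A generator with [N] points has [g < N < g^2], so the tree has
    [N^k] points in [[0,g^k)^2]: more than linearly and fewer than quadratically many in the
    side of the square. Follow a ray of cones with superlinear growth; two of them are
    translates by some [v], and their difference [D] is infinite, for otherwise the larger one
    would be [D + nat * v], of linear growth. A ray inside [D] gives a second period [w], and
    the points [z + m w + n v] are pairwise distinct: quadratic growth. *)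

(** * Cones of a grid tree *)

(** A system may have many terminal assemblies, of which only the common domain is known. One
    infinite assembly sequence filling the shape is therefore fixed, and all movies are read off it.
    The outside of the first cone and the inside of the second are filled at unrelated rates, so the
    replay runs on two clocks. They have to agree only on the two window blocks, through which all
    contact between inside and outside passes; this is why a movie records the order of arrival
    there. The spliced configurations need not be stages of the fixed sequence: they stay inside the
    shape because a fair continuation turns any of them into a producible terminal assembly. In the
    growth argument an infinite cone would not do for the first ray: it could be a periodic path,
    with finite [D]. Inside [D] an infinite ray is enough, because the second period only has to
    move a single point. The bound [g < N] comes from the first edge at the origin, which puts two
    generator points into one row or column; [N < g^2] comes from the missing cell. *)

Lemma point_dec (x y : point) : {x = y} + {x <> y}.
Proof. decide equality; apply Z.eq_dec. Defined.

Lemma adjacent_sym p q : adjacent p q -> adjacent q p.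
Proof. unfold adjacent; lia. Qed.

Lemma adjacent_neq p q : adjacent p q -> p <> q.
Proof. unfold adjacent; intros H ->; lia. Qed.

Lemma adjacent_irrefl p : ~ adjacent p p.
Proof. intros H; exact (adjacent_neq _ _ H eq_refl). Qed.

Definition nbrs (p : point) : list point :=
  let (x, y) := p in [(x + 1, y); (x - 1, y); (x, y + 1); (x, y - 1)].

Lemma nbrs_spec p q : In q (nbrs p) <-> adjacent p q.
Proof.
  destruct p as [x y], q as [x' y']; unfold adjacent; simpl; split.
  - intros [H|[H|[H|[H|[]]]]]; injection H; intros; lia.
  - intros H.
    assert (x' = x + 1 /\ y' = y \/ x' = x - 1 /\ y' = y \/
            x' = x /\ y' = y + 1 \/ x' = x /\ y' = y - 1)
      as [[-> ->]|[[-> ->]|[[-> ->]|[-> ->]]]] by lia; tauto.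
Qed.

Lemma last_cons {A} (z d : A) l : last (z :: l) d = last l z.
Proof.
  revert z d; induction l as [|a l IH]; intros z d; [reflexivity|].
  change (last (a :: l) d = last (a :: l) z); now rewrite !IH.
Qed.

Lemma last_in {A} (a d : A) l : In (last (a :: l) d) (a :: l).
Proof.
  revert a d; induction l as [|b l IH]; intros a d; [now left|].
  rewrite last_cons; right; apply IH.
Qed.

Lemma grid_path_app V x l y l' z :
  grid_path V x l y -> grid_path V y l' z -> grid_path V x (l ++ l') z.
Proof.
  revert x; induction l as [|a l IH]; simpl; intros x H H'.
  - now subst.
  - destruct H as (H1 & H2 & H3); eauto.
Qed.

Lemma grid_path_last V x l y : grid_path V x l y -> last l x = y.
Proof.
  revert x; induction l as [|a l IH]; intros x H; [exact H|].
  rewrite last_cons; apply IH, H.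
Qed.

Lemma grid_path_in V x l y z : grid_path V x l y -> In z l -> V z.
Proof.
  revert x; induction l as [|a l IH]; simpl; intros x H; [tauto|].
  intros [->|Hz]; [tauto|]; eapply IH; [apply H|assumption].
Qed.

Lemma grid_path_impl (V U : point -> Prop) x l y :
  (forall z, In z l -> V z -> U z) -> grid_path V x l y -> grid_path U x l y.
Proof.
  revert x; induction l as [|a l IH]; simpl; intros x H Hp; [assumption|].
  destruct Hp as (H1 & H2 & H3); repeat split; auto.
Qed.

Lemma grid_path_split V x l1 z l2 y :
  grid_path V x (l1 ++ z :: l2) y ->
  grid_path V x (l1 ++ [z]) z /\ grid_path V z l2 y.
Proof.
  revert x; induction l1 as [|a l IH]; simpl; intros x H.
  - tauto.
  - destruct H as (H1 & H2 & H3); destruct (IH _ H3); tauto.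
Qed.

Lemma grid_path_rev V x l y :
  V x -> grid_path V x l y -> exists l', grid_path V y l' x.
Proof.
  revert x; induction l as [|a l IH]; simpl; intros x Hx H.
  - exists []; simpl; congruence.
  - destruct H as (H1 & H2 & H3); destruct (IH _ H2 H3) as [l' Hl'].
    exists (l' ++ [x]); eapply grid_path_app; [exact Hl'|].
    simpl; auto using adjacent_sym.
Qed.

Lemma grid_path_simple V x l y :
  grid_path V x l y -> exists l', grid_path V x l' y /\ NoDup (x :: l').
Proof.
  revert x; induction l as [|a l IH]; intros x H.
  - exists []; split; [exact H|]; repeat constructor; simpl; tauto.
  - destruct H as (H1 & H2 & H3); destruct (IH _ H3) as (l' & Hp & Hn).
    destruct (in_dec point_dec x (a :: l')) as [Hi|Hi].
    + destruct (in_split _ _ Hi) as (l1 & l2 & E).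
      exists l2; split.
      * assert (Hq : grid_path V x (l1 ++ x :: l2) y) by (rewrite <- E; simpl; auto).
        apply (grid_path_split _ _ _ _ _ _ Hq).
      * rewrite E in Hn; clear - Hn; induction l1 as [|b l1 IH]; [exact Hn|].
        inversion Hn; auto.
    + exists (a :: l'); split; [simpl; auto|now constructor].
Qed.

Definition del (V : point -> Prop) (p : point) : point -> Prop := fun z => V z /\ z <> p.

(** A simple path from [r] to [r'] that avoids [q] closes up through [q] to a cycle. Every later use
    of acyclicity goes through this lemma. *)
Lemma tree_cut V q r r' l :
  ~ grid_has_cycle V -> V q -> V r -> adjacent q r -> adjacent q r' ->
  r <> q -> grid_path (del V q) r l r' -> r = r'.
Proof.
  intros Hac Vq Vr Hr Hr' Hrq Hp.
  destruct (grid_path_simple _ _ _ _ Hp) as (l' & Hp' & Hn).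
  destruct l' as [|b l']; [exact Hp'|].
  exfalso; apply Hac; exists q, (r :: b :: l').
  assert (E : last (r :: b :: l') q = r')
    by (rewrite last_cons; exact (grid_path_last _ _ _ _ Hp')).
  rewrite E; refine (conj _ (conj _ (conj Vq (conj _ (adjacent_sym _ _ Hr'))))).
  - constructor; [|exact Hn].
    intros [E'|Hi]; [congruence|].
    apply (grid_path_in _ _ _ _ _ Hp' Hi); reflexivity.
  - simpl; lia.
  - refine (conj Hr (conj Vr _)).
    apply (grid_path_impl (del V q) V r (b :: l')); [|exact Hp']; intros ? ? H; apply H.
Qed.

(** The vertex [p] may lie outside [V]; this lets the whole tree be the cone of an edge that enters
    it from outside. *)
Definition cone (V : point -> Prop) (p q z : point) : Prop :=
  exists l, grid_path (del V p) q l z.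

Lemma cone_self V p q : cone V p q q.
Proof. exists []; reflexivity. Qed.

Lemma cone_not_root V p q : p <> q -> ~ cone V p q p.
Proof.
  intros Hpq [l Hl]; destruct l as [|a l]; [simpl in Hl; congruence|].
  assert (E := grid_path_last _ _ _ _ Hl).
  assert (H : In p (a :: l)).
  { rewrite <- E; apply last_in. }
  apply (grid_path_in _ _ _ _ _ Hl H); reflexivity.
Qed.

Lemma cone_sub (V : point -> Prop) p q z : V q -> cone V p q z -> V z.
Proof.
  intros Vq [l Hl]; revert q Vq Hl; induction l as [|a l IH]; simpl; intros q Vq Hl.
  - now subst.
  - apply (IH a); apply Hl.
Qed.

Lemma cone_step V p q x y :
  cone V p q x -> adjacent x y -> V y -> y <> p -> cone V p q y.
Proof.
  intros [l Hl] Ha Vy Hy; exists (l ++ [y]); eapply grid_path_app; [exact Hl|].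
  simpl; unfold del; auto.
Qed.

(** A grid step to a vertex other than [p] stays in the cone, so [y = p]. Then [x] and [q] are
    neighbours of [p] joined by a path avoiding [p], and [tree_cut] identifies them. *)
Lemma cone_boundary V p q x y :
  ~ grid_has_cycle V -> V q -> adjacent p q ->
  cone V p q x -> V y -> ~ cone V p q y -> adjacent x y -> x = q /\ y = p.
Proof.
  intros Hac Vq Ha Hx Vy Hy Hxy.
  assert (y = p) as ->.
  { apply NNPP; intros H; apply Hy; eapply cone_step; eauto. }
  split; [|reflexivity]; destruct Hx as [l Hl]; symmetry.
  eapply (tree_cut V p); eauto using adjacent_sym.
  intros ->; eapply adjacent_irrefl; eauto.
Qed.

Lemma cone_decomp V p q z :
  cone V p q z ->
  z = q \/ exists r, adjacent q r /\ V r /\ r <> p /\ cone V q r z.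
Proof.
  intros [l Hl]; destruct (grid_path_simple _ _ _ _ Hl) as (l' & Hl' & Hn).
  destruct l' as [|r l']; [left; simpl in Hl'; congruence|right].
  destruct Hl' as (H1 & [H2 H2'] & H3); exists r; repeat split; auto.
  exists l'; eapply grid_path_impl; [|exact H3]; intros x Hx [Hv _]; split; [exact Hv|].
  intros ->; inversion Hn as [|? ? Hni _]; apply Hni; now right.
Qed.

(** A path from [r] avoiding [q] cannot meet [p]: it would join two distinct neighbours of [q]
    outside [q]. Prefixing [q] then gives a path avoiding [p]. *)
Lemma cone_nested V p q r z :
  ~ grid_has_cycle V -> V q -> V r -> adjacent p q -> adjacent q r -> r <> p ->
  cone V q r z -> cone V p q z.
Proof.
  intros Hac Vq Vr Hpq Hqr Hrp [l Hl].
  exists (r :: l); repeat split; auto.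
  eapply grid_path_impl; [|exact Hl]; intros x Hx [Vx _]; split; [exact Vx|].
  intros ->; apply Hrp.
  destruct (in_split _ _ Hx) as (l1 & l2 & ->).
  destruct (grid_path_split _ _ _ _ _ _ Hl) as [H _].
  eapply (tree_cut V q); eauto using adjacent_sym.
  intros ->; eapply adjacent_irrefl; eauto.
Qed.

Lemma cone_disjoint V q r r' z :
  ~ grid_has_cycle V -> V q -> V r -> V r' -> adjacent q r -> adjacent q r' ->
  cone V q r z -> cone V q r' z -> r = r'.
Proof.
  intros Hac Vq Vr Vr' Hr Hr' [l Hl] [l' Hl'].
  assert (Hd : forall s, V s -> adjacent q s -> del V q s).
  { intros s Vs Hs; split; [exact Vs|]; intros ->; eapply adjacent_irrefl; eauto. }
  destruct (grid_path_rev _ _ _ _ (Hd _ Vr' Hr') Hl') as [m Hm].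
  eapply (tree_cut V q r r' (l ++ m)); eauto using grid_path_app.
  intros ->; eapply adjacent_irrefl; eauto.
Qed.

(** A path into the cone has to step from [p] to [q], and what remains after that step is shorter.
    The length serves as the descent measure in [ray_leaves]. *)
Lemma cone_enter V p q x l z :
  ~ grid_has_cycle V -> V q -> adjacent p q -> V x ->
  grid_path V x l z -> ~ cone V p q x -> cone V p q z ->
  exists l', (length l' < length l)%nat /\ grid_path V q l' z.
Proof.
  intros Hac Vq Ha; revert x; induction l as [|y l IH]; simpl; intros x Vx Hl Hx Hz.
  - now subst.
  - destruct Hl as (H1 & H2 & H3).
    destruct (classic (cone V p q y)) as [Hy|Hy].
    + destruct (cone_boundary V p q y x) as [-> _]; auto using adjacent_sym.
      exists l; split; [lia|exact H3].
    + destruct (IH y) as (l' & ? & ?); auto; exists l'; split; [lia|assumption].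
Qed.

(** Large sets form the complement of an ideal that contains the singletons. The abstraction lets
    one König argument serve both for infinite sets and for sets of nonlinear growth. *)
Record largeness (P : (point -> Prop) -> Prop) : Prop := {
  large_mono : forall A B : point -> Prop, (forall z, A z -> B z) -> P A -> P B;
  large_union : forall A B, P (fun z => A z \/ B z) -> P A \/ P B;
  large_single : forall q, ~ P (fun z => z = q) }.

Lemma large_list_union P (I : Type) (B : I -> point -> Prop) (L : list I) :
  largeness P -> P (fun z => exists i, In i L /\ B i z) -> exists i, In i L /\ P (B i).
Proof.
  intros HP; induction L as [|i L IH]; intros H.
  - exfalso; apply (large_single P HP (0, 0)); eapply large_mono; [exact HP| |exact H].
    intros z (? & [] & _).
  - destruct (large_union P HP (B i) (fun z => exists i, In i L /\ B i z)) as [H'|H'].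
    + eapply large_mono; [exact HP| |exact H]; intros z (j & [->|Hj] & Hz); eauto.
    + exists i; split; [now left|exact H'].
    + destruct (IH H') as (j & ? & ?); exists j; split; [now right|assumption].
Qed.

(** Apart from its root, a cone is a union of at most four child cones, so one of them is large. *)
Lemma large_child P V p q :
  largeness P -> P (cone V p q) ->
  exists r, adjacent q r /\ V r /\ r <> p /\ P (cone V q r).
Proof.
  intros HP H.
  destruct (large_union P HP (fun z => z = q)
     (fun z => exists r, In r (nbrs q) /\ (V r /\ r <> p /\ cone V q r z))) as [H'|H'].
  - eapply large_mono; [exact HP| |exact H]; intros z Hz.
    destruct (cone_decomp _ _ _ _ Hz) as [E|(r & H1 & H2)]; [now left|right].
    exists r; rewrite nbrs_spec; tauto.
  - now apply large_single in H'.
  - apply (large_list_union P _ (fun r z => V r /\ r <> p /\ cone V q r z)) in H'; [|exact HP].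
    destruct H' as (r & Hr & Hb); rewrite nbrs_spec in Hr; exists r.
    (* Otherwise this member of the union is empty, hence not large. *)
    assert (V r /\ r <> p) as [Vr Hrp].
    { apply NNPP; intros Hn; apply (large_single P HP q).
      eapply large_mono; [exact HP| |exact Hb]; intros z; tauto. }
    repeat split; auto; eapply large_mono; [exact HP| |exact Hb]; intros z; tauto.
Qed.

(** Membership in [V] starts at index 1, so that a ray may begin at a vertex outside the tree. *)
Definition ray (V : point -> Prop) (r : nat -> point) : Prop :=
  forall n, adjacent (r n) (r (S n)) /\ V (r (S n)) /\ r (S (S n)) <> r n.

Lemma ray_exists P V p q :
  largeness P -> V q -> adjacent p q -> P (cone V p q) ->
  exists r, r O = p /\ r 1%nat = q /\ ray V r /\ forall n, P (cone V (r n) (r (S n))).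
Proof.
  intros HP Vq Ha H.
  pose (E := {e : point * point | V (snd e) /\ adjacent (fst e) (snd e) /\ P (cone V (fst e) (snd e))}).
  assert (step : forall e : E, {e' : E | fst (proj1_sig e') = snd (proj1_sig e) /\
                                         snd (proj1_sig e') <> fst (proj1_sig e)}).
  { intros [[a b] (Vb & Hab & Hc)]; apply constructive_indefinite_description; simpl in *.
    destruct (large_child P V a b HP Hc) as (r & H1 & H2 & H3 & H4).
    unshelve eexists.
    - exists (b, r); auto.
    - simpl; auto. }
  pose (e0 := exist _ (p, q) (conj Vq (conj Ha H)) : E).
  pose (f := fix f n := match n with O => e0 | S n => proj1_sig (step (f n)) end).
  assert (Hf : forall n, fst (proj1_sig (f (S n))) = snd (proj1_sig (f n)) /\
                         snd (proj1_sig (f (S n))) <> fst (proj1_sig (f n))).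
  { intros n; simpl; apply (proj2_sig (step (f n))). }
  exists (fun n => fst (proj1_sig (f n))); split; [reflexivity|split; [|split]].
  - apply Hf.
  - intros n; destruct (Hf n) as [H1 H2], (Hf (S n)) as [H3 H4].
    rewrite H3, H1; repeat split; try assumption; apply (proj2_sig (f n)).
  - intros n; destruct (Hf n) as [H1 _]; rewrite H1; apply (proj2_sig (f n)).
Qed.

Lemma ray_nested V r : ~ grid_has_cycle V -> ray V r ->
  forall m n z, (m <= n)%nat -> cone V (r n) (r (S n)) z -> cone V (r m) (r (S m)) z.
Proof.
  intros Hac Hr m n z Hmn; induction Hmn as [|n Hmn IH]; [auto|].
  intros Hz; apply IH.
  destruct (Hr n) as (? & ? & ?), (Hr (S n)) as (? & ? & ?).
  eapply (cone_nested V _ (r (S n)) (r (S (S n)))); eauto.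
Qed.

Lemma ray_tip_out V r : ~ grid_has_cycle V -> ray V r ->
  forall m n, (m < n)%nat -> ~ cone V (r n) (r (S n)) (r (S m)).
Proof.
  intros Hac Hr m n Hmn H.
  apply (ray_nested V r Hac Hr (S m) n) in H; [|lia].
  destruct (Hr (S m)) as (Ha & _); apply adjacent_neq in Ha.
  exact (cone_not_root _ _ _ Ha H).
Qed.

(** If [z] lay in all the cones, a path from [r (S k)] to [z] would enter the next cone and leave a
    strictly shorter path from [r (S (S k))], without end. *)
Lemma ray_leaves V r z : ~ grid_has_cycle V -> ray V r ->
  exists n, ~ cone V (r n) (r (S n)) z.
Proof.
  intros Hac Hr; apply NNPP; intros Hn.
  assert (Hall : forall n, cone V (r n) (r (S n)) z) by (intros n; apply NNPP; eauto).
  assert (Hlen : forall L k l, (length l <= L)%nat -> grid_path V (r (S k)) l z -> False).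
  { induction L as [|L IH]; intros k l Hl Hp;
      destruct (Hr k) as (_ & Vk & _), (Hr (S k)) as (Ha & Vk' & _);
      destruct (cone_enter V (r (S k)) (r (S (S k))) (r (S k)) l z)
        as (l' & Hl' & Hp'); auto.
    - apply ray_tip_out; auto.
    - lia.
    - apply ray_tip_out; auto.
    - eapply (IH (S k) l'); [lia|exact Hp']. }
  destruct (Hall O) as [l Hl].
  eapply (Hlen (length l) O l); [lia|].
  eapply grid_path_impl; [|exact Hl]; intros ? ? H; apply H.
Qed.

Lemma ray_leaves_list V r S0 : ~ grid_has_cycle V -> ray V r ->
  exists n, forall m z, (n <= m)%nat -> In z S0 -> ~ cone V (r m) (r (S m)) z.
Proof.
  intros Hac Hr; induction S0 as [|s S0 [n Hn]].
  - exists O; intros m z _ [].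
  - destruct (ray_leaves V r s Hac Hr) as [n' Hn'].
    exists (Nat.max n n'); intros m z Hm [<-|Hz] Hc.
    + apply Hn', (ray_nested V r Hac Hr n' m); [lia|exact Hc].
    + eapply (Hn m); [lia|exact Hz|exact Hc].
Qed.

(** * Trees with finitely many cone types *)

Definition translate (z v : point) : point := (fst z + fst v, snd z + snd v).
Definition diff (z w : point) : point := (fst z - fst w, snd z - snd w).
Definition nmul (n : nat) (v : point) : point := (Z.of_nat n * fst v, Z.of_nat n * snd v).
Definition box (n : nat) (z : point) : Prop :=
  0 <= fst z < Z.of_nat n /\ 0 <= snd z < Z.of_nat n.

Definition linear (A : point -> Prop) : Prop :=
  exists K : nat, forall n : nat, exists l : list point,
    (length l <= K * (n + 1))%nat /\ forall z, A z -> box n z -> In z l.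

Definition infinite (A : point -> Prop) : Prop := ~ exists l : list point, forall z, A z -> In z l.

Lemma point_eq (p q : point) : fst p = fst q -> snd p = snd q -> p = q.
Proof. destruct p, q; simpl; congruence. Qed.

Lemma nonlinear_large : largeness (fun A => ~ linear A).
Proof.
  split.
  - intros A B HAB HA [K HK]; apply HA; exists K; intros n.
    destruct (HK n) as (l & H1 & H2); exists l; split; auto.
  - intros A B H; apply NNPP; intros Hn; apply not_or_and in Hn as [H1 H2].
    apply NNPP in H1, H2; destruct H1 as [K1 H1], H2 as [K2 H2]; apply H.
    exists (K1 + K2)%nat; intros n.
    destruct (H1 n) as (l1 & L1 & I1), (H2 n) as (l2 & L2 & I2).
    exists (l1 ++ l2); split.
    + rewrite length_app; lia.
    + intros z [Hz|Hz] Hb; apply in_or_app; auto.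
  - intros q H; apply H; exists 1%nat; intros n; exists [q]; split; [simpl; lia|].
    intros z -> _; now left.
Qed.

Lemma infinite_large : largeness infinite.
Proof.
  split.
  - intros A B HAB HA [l Hl]; apply HA; exists l; auto.
  - intros A B H; apply NNPP; intros Hn; apply not_or_and in Hn as [H1 H2].
    apply NNPP in H1, H2; destruct H1 as [l1 H1], H2 as [l2 H2]; apply H.
    exists (l1 ++ l2); intros z [Hz|Hz]; apply in_or_app; auto.
  - intros q H; apply H; exists [q]; intros z ->; now left.
Qed.

Lemma NoDup_list_prod {A B} (l : list A) (l' : list B) :
  NoDup l -> NoDup l' -> NoDup (list_prod l l').
Proof.
  intros Hl Hl'; induction Hl as [|a l Ha Hl IH]; simpl; [constructor|].
  apply NoDup_app; [|exact IH|].
  - apply NoDup_map_NoDup_ForallPairs; [congruence|exact Hl'].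
  - intros p Hp Hp'; apply in_map_iff in Hp as (b & <- & _).
    apply in_prod_iff in Hp'; tauto.
Qed.

Lemma pigeonhole {A} (f : nat -> A) (L : list A) n0 :
  (forall n, (n0 <= n)%nat -> In (f n) L) ->
  exists i j, (n0 <= i)%nat /\ (i < j)%nat /\ f i = f j.
Proof.
  intros H; apply NNPP; intros Hn.
  assert (Hnd : NoDup (map f (seq n0 (S (length L))))).
  { apply NoDup_map_NoDup_ForallPairs; [|apply seq_NoDup].
    intros a b Ha Hb E; apply in_seq in Ha, Hb.
    destruct (Nat.lt_total a b) as [Hl|[Hl|Hl]]; [|exact Hl|];
      exfalso; apply Hn; [exists a, b|exists b, a]; repeat split; (lia || congruence). }
  apply NoDup_incl_length with (l' := L) in Hnd.
  - rewrite length_map, length_seq in Hnd; lia.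
  - intros a Ha; apply in_map_iff in Ha as (x & <- & Hx); apply in_seq in Hx.
    apply H; lia.
Qed.

(** The list [S0] will hold the blocks met by the seed: along a good edge both window blocks and the
    whole cone are filled by attachments only. *)
Definition good (V : point -> Prop) (S0 : list point) (p q : point) : Prop :=
  V p /\ V q /\ adjacent p q /\ ~ In p S0 /\ forall z, cone V p q z -> ~ In z S0.

Lemma iterate_translate (C : point -> Prop) v :
  (forall z, C z -> C (translate z v)) -> forall n z, C z -> C (translate z (nmul n v)).
Proof.
  intros H n z Hz; induction n as [|n IH].
  - replace (translate z (nmul 0 v)) with z; [exact Hz|].
    apply point_eq; unfold translate, nmul; cbn [fst snd]; nia.
  - replace (translate z (nmul (S n) v)) with (translate (translate z (nmul n v)) v); [auto|].
    apply point_eq; unfold translate, nmul; cbn [fst snd]; nia.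
Qed.

(** Iterating a translation with a negative coordinate would push [z] out of the quadrant. *)
Lemma period_nonneg (C : point -> Prop) v z :
  (forall z, C z -> 0 <= fst z /\ 0 <= snd z) ->
  (forall z, C z -> C (translate z v)) -> C z -> 0 <= fst v /\ 0 <= snd v.
Proof.
  intros Hp Hs Hz; pose proof (Hp _ Hz).
  split; apply Z.nlt_ge; intros Hv.
  - destruct (Hp _ (iterate_translate C v Hs (Z.to_nat (fst z + 1)) z Hz)) as [H1 H2].
    unfold translate, nmul in H1; simpl in H1; nia.
  - destruct (Hp _ (iterate_translate C v Hs (Z.to_nat (snd z + 1)) z Hz)) as [H1 H2].
    unfold translate, nmul in H2; simpl in H2; nia.
Qed.

(** The sign conditions make the coordinate sum grow strictly under translation by [v]; it is the
    measure in the counting arguments below. *)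
Definition periodic (C C' : point -> Prop) (v : point) : Prop :=
  (forall z, C z <-> C' (translate z v)) /\ (forall z, C' z -> C z) /\
  0 <= fst v /\ 0 <= snd v /\ 0 < fst v + snd v.

(** Two edges of the ray share a colour, so their cones are translates, and nested. The vector is
    nonzero because [r (S i)] does not lie in the later cone. The colour is kept abstract; it will
    be the window movie. *)
Lemma ray_periodic V S0 {A} (color : point -> point -> A) L r n0 :
  ~ grid_has_cycle V -> (forall z, V z -> 0 <= fst z /\ 0 <= snd z) -> ray V r ->
  (forall p q, good V S0 p q -> In (color p q) L) ->
  (forall p q p' q', good V S0 p q -> good V S0 p' q' -> color p q = color p' q' ->
     forall z, cone V p q z <-> cone V p' q' (translate z (diff q' q))) ->
  (forall n, (n0 <= n)%nat -> good V S0 (r n) (r (S n))) ->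
  exists i j v, (n0 <= i)%nat /\ (i < j)%nat /\
    periodic (cone V (r i) (r (S i))) (cone V (r j) (r (S j))) v.
Proof.
  intros Hac Hpos Hr HL Hcol Hg.
  destruct (pigeonhole (fun n => color (r n) (r (S n))) L n0) as (i & j & Hi & Hij & E).
  { auto. }
  exists i, j, (diff (r (S j)) (r (S i))); split; [exact Hi|split; [exact Hij|]].
  assert (Hz := Hcol _ _ _ _ (Hg i Hi) (Hg j ltac:(lia)) E).
  assert (Hn : forall z, cone V (r j) (r (S j)) z -> cone V (r i) (r (S i)) z).
  { intros z; apply ray_nested; auto; lia. }
  assert (Hv := period_nonneg (cone V (r i) (r (S i))) (diff (r (S j)) (r (S i))) (r (S i))).
  destruct Hv as [Hv1 Hv2].
  - intros z Hc; apply Hpos, (cone_sub V _ _ _ (proj1 (proj2 (Hr i))) Hc).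
  - intros z Hc; apply Hn, Hz, Hc.
  - apply cone_self.
  - split; [exact Hz|split; [exact Hn|split; [exact Hv1|split; [exact Hv2|]]]].
    apply Z.nle_gt; intros Hv.
    assert (r (S i) = r (S j)).
    { apply point_eq; unfold diff in *; simpl in *; lia. }
    apply (ray_tip_out V r Hac Hr i j Hij); rewrite H; apply cone_self.
Qed.

(** Between two cones of a ray there are only finitely many ray vertices and the side branches
    hanging off them, so a large difference contains a large branch. *)
Lemma large_branch P V r i j :
  largeness P -> ~ grid_has_cycle V -> ray V r -> (i <= j)%nat ->
  P (fun z => cone V (r i) (r (S i)) z /\ ~ cone V (r j) (r (S j)) z) ->
  exists p q, V q /\ adjacent p q /\ P (cone V p q) /\ cone V (r i) (r (S i)) p /\
    forall z, cone V p q z -> cone V (r i) (r (S i)) z /\ ~ cone V (r j) (r (S j)) z.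
Proof.
  intros HP Hac Hr Hij; induction Hij as [|j Hij IH]; intros H.
  - exfalso; apply (large_single P HP (0, 0)); eapply large_mono; [exact HP| |exact H].
    intros z; tauto.
  - destruct (Hr j) as (Ha & Vj & _), (Hr (S j)) as (Ha' & Vj' & Hne).
    destruct (large_union P HP
      (fun z => cone V (r i) (r (S i)) z /\ ~ cone V (r j) (r (S j)) z)
      (fun z => cone V (r j) (r (S j)) z /\ ~ cone V (r (S j)) (r (S (S j))) z)) as [H'|H'].
    + eapply large_mono; [exact HP| |exact H]; intros z.
      destruct (classic (cone V (r j) (r (S j)) z)); tauto.
    + destruct (IH H') as (p & q & Vq & Hpq & Pc & Hp & Hc).
      exists p, q; split; [exact Vq|split; [exact Hpq|split; [exact Pc|split; [exact Hp|]]]].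
      intros z Hz; destruct (Hc z Hz) as [H1 H2]; split; [exact H1|].
      intros H3; apply H2, (ray_nested V r Hac Hr j (S j)); [lia|exact H3].
    + destruct (large_union P HP (fun z => z = r (S j))
        (fun z => exists q, In q (nbrs (r (S j))) /\
           (V q /\ q <> r j /\ q <> r (S (S j)) /\ cone V (r (S j)) q z))) as [H2|H2].
      * eapply large_mono; [exact HP| |exact H']; intros z [Hz Hz'].
        destruct (cone_decomp _ _ _ _ Hz) as [E|(q & H1 & H2 & H3 & H4)]; [now left|right].
        exists q; rewrite nbrs_spec; repeat split; auto; intros ->; tauto.
      * now apply large_single in H2.
      * apply (large_list_union P _
          (fun q z => V q /\ q <> r j /\ q <> r (S (S j)) /\ cone V (r (S j)) q z)) in H2; [|exact HP].
        destruct H2 as (q & Hq & H2); rewrite nbrs_spec in Hq; exists (r (S j)), q.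
        assert (V q /\ q <> r j /\ q <> r (S (S j))) as (Vq & Hq1 & Hq2).
        { apply NNPP; intros Hn; apply (large_single P HP q).
          eapply large_mono; [exact HP| |exact H2]; intros z; tauto. }
        split; [exact Vq|split; [exact Hq|split; [|split]]].
        -- eapply large_mono; [exact HP| |exact H2]; intros z; tauto.
        -- apply (ray_nested V r Hac Hr i j _ Hij), cone_self.
        -- intros z Hz; split.
           ++ apply (ray_nested V r Hac Hr i j _ Hij).
              apply (cone_nested V _ (r (S j)) q); auto.
           ++ intros Hz'; apply Hq2.
              exact (cone_disjoint V (r (S j)) _ _ z Hac Vj Vq Vj' Hq Ha' Hz Hz').
Qed.

(** Subtracting [v] as long as the point lies in [C'] lowers the coordinate sum and ends in the
    difference: every point of [C] is a point of the finite difference plus a multiple of [v]. *)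
Lemma periodic_linear (C C' : point -> Prop) v :
  (forall z, C z -> 0 <= fst z /\ 0 <= snd z) ->
  periodic C C' v -> ~ infinite (fun z => C z /\ ~ C' z) -> linear C.
Proof.
  intros Hpos (Hv & Hs & Hv1 & Hv2 & Hv3) Hf; apply NNPP in Hf; destruct Hf as [l Hl].
  assert (Hrep : forall n z, fst z + snd z < Z.of_nat n -> C z ->
            exists d m, C d /\ In d l /\ z = translate d (nmul m v)).
  { induction n as [|n IH]; intros z Hz Cz; [specialize (Hpos z Cz); lia|].
    destruct (classic (C' z)) as [Cz'|Cz'].
    - assert (E : z = translate (diff z v) v).
      { apply point_eq; unfold translate, diff; simpl; lia. }
      rewrite E in Cz'; apply Hv in Cz'.
      destruct (IH (diff z v)) as (d & m & Cd & Hd & Em); [unfold diff; simpl; lia|exact Cz'|].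
      exists d, (S m); split; [exact Cd|split; [exact Hd|]].
      rewrite E, Em; apply point_eq; unfold translate, nmul; cbn [fst snd]; nia.
    - exists z, O; split; [exact Cz|split; [auto|]].
      apply point_eq; unfold translate, nmul; cbn [fst snd]; nia. }
  (* The coordinate sum of [v] is at least 1 and that of a point of the box is below [2 * n], so
     fewer than [2 * n] multiples of [v] occur over each point of [l]. *)
  exists (2 * length l)%nat; intros n.
  exists (map (fun dm => translate (fst dm) (nmul (snd dm) v)) (list_prod l (seq 0 (2 * n)))); split.
  - rewrite length_map, length_prod, length_seq; nia.
  - intros z Cz [Hb1 Hb2].
    destruct (Hrep (Z.to_nat (fst z + snd z + 1)) z) as (d & m & Cd & Hd & E); [lia|exact Cz|].
    apply in_map_iff; exists (d, m); split; [now symmetry|].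
    apply in_prod; [exact Hd|]; apply in_seq.
    specialize (Hpos d Cd); subst z; unfold translate, nmul in *; cbn [fst snd] in *; nia.
Qed.

(** For distinct multiples of [v] the points differ: after cancelling the smaller multiple, one of
    them lies in [E], hence outside [C'], while the other keeps a positive multiple of [v] and lies
    in [C']. For equal multiples of [v] the multiples of [w] are told apart by the coordinate
    sum. *)
Lemma two_periods_quadratic (C C' E E' : point -> Prop) v w (z0 : point) :
  (forall z, C z -> 0 <= fst z /\ 0 <= snd z) ->
  periodic C C' v -> periodic E E' w -> (forall z, E z -> C z /\ ~ C' z) -> E z0 ->
  exists A : nat, forall M : nat, exists l : list point,
    NoDup l /\ length l = (M * M)%nat /\ forall z, In z l -> C z /\ box (A * M) z.
Proof.
  intros Hpos (Hv & Hs & Hv1 & Hv2 & Hv3) (Hw & Ht & Hw1 & Hw2 & Hw3) HE Hz0.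
  pose (f := fun mn : nat * nat => translate (translate z0 (nmul (fst mn) w)) (nmul (snd mn) v)).
  assert (HEm : forall m, E (translate z0 (nmul m w))).
  { intros m; apply iterate_translate; [|exact Hz0]; intros z Hz; apply Ht, Hw, Hz. }
  assert (HC : forall n z, C z -> C (translate z (nmul n v))).
  { apply iterate_translate; intros z Hz; apply Hs, Hv, Hz. }
  assert (Hlt : forall m n m' n', (n < n')%nat -> f (m, n) <> f (m', n')).
  { intros m n m' n' Hn Ef.
    apply (proj2 (HE _ (HEm m))).
    assert (X : translate z0 (nmul m w) =
      translate (translate (translate z0 (nmul m' w)) (nmul (n' - n - 1) v)) v).
    { unfold f in Ef; injection Ef; intros E2 E1.
      apply point_eq; unfold translate, nmul in *; cbn [fst snd] in *; nia. }
    rewrite X; apply Hv, HC, HE, HEm. }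
  exists (Z.to_nat (1 + fst z0 + snd z0 + fst v + snd v + fst w + snd w)); intros M.
  exists (map f (list_prod (seq 0 M) (seq 0 M))); split; [|split].
  - apply NoDup_map_NoDup_ForallPairs.
    + intros [m n] [m' n'] _ _ Ef.
      destruct (Nat.lt_total n n') as [Hn|[Hn|Hn]].
      * now apply Hlt in Ef.
      * subst n'; f_equal; unfold f in Ef; injection Ef; intros E2 E1.
        unfold translate, nmul in *; cbn [fst snd] in *.
        apply Nat2Z.inj, (Z.mul_reg_r _ _ (fst w + snd w)); [lia|].
        rewrite !Z.mul_add_distr_l; lia.
      * symmetry in Ef; now apply Hlt in Ef.
    + apply NoDup_list_prod; apply seq_NoDup.
  - rewrite length_map, length_prod, !length_seq; reflexivity.
  - intros z Hz; apply in_map_iff in Hz as ([m n] & <- & Hmn).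
    apply in_prod_iff in Hmn as [Hm Hn]; apply in_seq in Hm, Hn.
    unfold f; cbn [fst snd]; split; [apply HC, HE, HEm|].
    destruct (Hpos z0) as [P1 P2]; [apply HE, Hz0|].
    unfold box, translate, nmul; cbn [fst snd]; nia.
Qed.

Theorem finite_cone_types_absurd V S0 {A} (color : point -> point -> A) L o :
  ~ grid_has_cycle V -> (forall z, V z -> 0 <= fst z /\ 0 <= snd z) ->
  V o -> (forall z, V z -> exists l, grid_path V o l z) -> (fst o = 0) ->
  (forall p q, good V S0 p q -> In (color p q) L) ->
  (forall p q p' q', good V S0 p q -> good V S0 p' q' -> color p q = color p' q' ->
     forall z, cone V p q z <-> cone V p' q' (translate z (diff q' q))) ->
  ~ linear V ->
  (forall B : nat, exists M : nat, forall l, NoDup l ->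
     (forall z, In z l -> V z /\ box (B * M) z) -> (length l < M * M)%nat) ->
  False.
Proof.
  intros Hac Hpos Vo Hcon Ho HL Hcol Hnl Hq.
  (* a fictitious parent of the root, so that all of [V] is a cone *)
  pose (o' := (-1, snd o) : point).
  assert (Ho' : adjacent o' o) by (unfold adjacent, o'; cbn [fst snd]; lia).
  destruct (ray_exists _ V o' o nonlinear_large Vo Ho') as (r & _ & _ & Hr & Hnlr).
  { intros Hl; apply Hnl; destruct Hl as [K HK]; exists K; intros n.
    destruct (HK n) as (l & H1 & H2); exists l; split; [exact H1|].
    intros z Vz; apply H2; destruct (Hcon z Vz) as [m Hm]; exists m.
    eapply grid_path_impl; [|exact Hm]; intros x _ Vx; split; [exact Vx|].
    intros ->; specialize (Hpos _ Vx); unfold o' in Hpos; simpl in Hpos; lia. }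
  destruct (ray_leaves_list V r S0 Hac Hr) as [n0 Hn0].
  (* The shift by one is needed because goodness also asks that [r n] itself be in the tree and off
     the seed, and [r n] belongs to the preceding cone. *)
  assert (Hg : forall n, (S n0 <= n)%nat -> good V S0 (r n) (r (S n))).
  { intros [|n] Hn; [lia|]; destruct (Hr n) as (_ & V1 & _), (Hr (S n)) as (Ha & V2 & _).
    split; [exact V1|split; [exact V2|split; [exact Ha|split]]].
    - intros Hi; apply (Hn0 n (r (S n))); [lia|exact Hi|apply cone_self].
    - intros z Hz Hi; apply (Hn0 (S n) z); [lia|exact Hi|exact Hz]. }
  destruct (ray_periodic V S0 color L r (S n0) Hac Hpos Hr HL Hcol Hg)
    as (i & j & v & Hi & Hij & Hv).
  assert (HposC : forall k z, cone V (r k) (r (S k)) z -> 0 <= fst z /\ 0 <= snd z).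
  { intros k z Hz; apply Hpos, (cone_sub V _ _ _ (proj1 (proj2 (Hr k))) Hz). }
  assert (Hinf : infinite (fun z => cone V (r i) (r (S i)) z /\ ~ cone V (r j) (r (S j)) z)).
  { apply NNPP; intros Hf; apply (Hnlr i).
    eapply periodic_linear; [apply HposC|exact Hv|exact Hf]. }
  destruct (large_branch _ V r i j infinite_large Hac Hr ltac:(lia) Hinf)
    as (p & q & Vq & Hpq & Hpi & Hp & Hc).
  assert (Hgi := Hg i Hi).
  destruct (ray_exists _ V p q infinite_large Vq Hpq Hpi) as (s & Es0 & Es1 & Hsr & _).
  assert (Hsub : forall n z, cone V (s n) (s (S n)) z -> cone V p q z).
  { intros n z Hz; rewrite <- Es0, <- Es1.
    apply (ray_nested V s Hac Hsr O n); [lia|exact Hz]. }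
  (* All of [s], including its start [p], lies in a cone of the first ray that avoids the seed, so
     every edge of [s] is good from index 0 on. *)
  assert (Hci : forall n, cone V (r i) (r (S i)) (s n)).
  { intros [|n]; [now rewrite Es0|]; apply Hc, (Hsub n), cone_self. }
  destruct (ray_periodic V S0 color L s O Hac Hpos Hsr HL Hcol) as (k & l & w & _ & _ & Hw).
  { intros n _; destruct (Hsr n) as (Ha & V2 & _), Hgi as (_ & Vi & _ & _ & Hgi).
    split; [apply (cone_sub V _ _ _ Vi (Hci n))|split; [exact V2|split; [exact Ha|split]]].
    - apply Hgi, Hci.
    - intros z Hz; apply Hgi, Hc, (Hsub n), Hz. }
  destruct (two_periods_quadratic _ _ _ _ _ _ (s (S k)) (HposC i) Hv Hw) as [B HB].
  { intros z Hz; apply Hc, (Hsub k), Hz. }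
  { apply cone_self. }
  destruct (Hq B) as [M HM], (HB M) as (m & Hm1 & Hm2 & Hm3).
  specialize (HM m Hm1); rewrite Hm2 in HM; apply (Nat.lt_irrefl (M * M)), HM.
  intros z Hz; destruct (Hm3 z Hz) as [Hz1 Hz2]; split; [|exact Hz2].
  exact (cone_sub V _ _ _ (proj1 (proj2 (Hr i))) Hz1).
Qed.

(** * Growth of self-similar fractals *)

(** Bernoulli's inequality [(1 + 1/n)^(n*m) >= 1 + m] without denominators: the ratio of two such
    exponentials exceeds any prescribed constant. *)
Lemma bernoulli_nat n m : (1 <= n)%nat -> ((m + 1) * n ^ (n * m) <= (n + 1) ^ (n * m))%nat.
Proof.
  intros Hn.
  assert (H : forall j, ((n + j) * n ^ j <= n * (n + 1) ^ j)%nat).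
  { induction j as [|j IH]; simpl; [lia|].
    generalize dependent (n ^ j)%nat; generalize dependent ((n + 1) ^ j)%nat; intros; nia. }
  specialize (H (n * m)%nat).
  generalize dependent (n ^ (n * m))%nat; generalize dependent ((n + 1) ^ (n * m))%nat; intros; nia.
Qed.

Definition toZ (p : nat * nat) : point := (Z.of_nat (fst p), Z.of_nat (snd p)).

Lemma in_decidable_list {A} (P : A -> Prop) (L : list A) :
  NoDup L -> exists l, NoDup l /\ forall x, In x l <-> In x L /\ P x.
Proof.
  intros HL.
  exists (filter (fun x => if excluded_middle_informative (P x) then true else false) L); split.
  - now apply NoDup_filter.
  - intros x; rewrite filter_In; destruct (excluded_middle_informative (P x)); intuition congruence.
Qed.

Lemma Xs_bound g G k p : is_generator g G -> Xs g G k p ->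
  (fst p < g ^ S k /\ snd p < g ^ S k)%nat.
Proof.
  intros (HG & _); revert p; induction k as [|k IH]; intros p H.
  - apply HG in H; simpl; lia.
  - destruct H as (m & n & Hm & Hn & ->); apply IH in Hm; apply HG in Hn.
    cbn [fst snd]; rewrite !(Nat.pow_succ_r' g (S k)); nia.
Qed.

Lemma Xs_le g G j k p : is_generator g G -> (j <= k)%nat -> Xs g G j p -> Xs g G k p.
Proof.
  intros (_ & H0 & _) Hjk H; induction Hjk as [|k Hjk IH]; [exact H|].
  exists p, (0, 0)%nat; split; [exact IH|split; [exact H0|]].
  destruct p; cbn [fst snd]; f_equal; lia.
Qed.

Lemma Xs_restrict g G j k p : is_generator g G -> Xs g G j p ->
  (fst p < g ^ S k)%nat -> (snd p < g ^ S k)%nat -> Xs g G k p.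
Proof.
  intros HG Hj H1 H2; destruct (Nat.le_gt_cases j k) as [Hjk|Hjk].
  - now apply (Xs_le g G j).
  - revert Hj; induction Hjk as [|j Hjk IH]; intros Hj.
    + destruct Hj as ([m1 m2] & [n1 n2] & Hm & Hn & ->); cbn [fst snd] in *.
      assert (n1 = 0 /\ n2 = 0)%nat as [-> ->] by nia.
      rewrite !Nat.mul_0_r, !Nat.add_0_r; exact Hm.
    + assert (Hp : (g ^ S k <= g ^ S j)%nat).
      { apply Nat.pow_le_mono_r; [|lia]; intros ->; simpl in H1; lia. }
      apply IH; destruct Hj as ([m1 m2] & [n1 n2] & Hm & Hn & ->); cbn [fst snd] in *.
      assert (n1 = 0 /\ n2 = 0)%nat as [-> ->] by nia.
      rewrite !Nat.mul_0_r, !Nat.add_0_r; exact Hm.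
Qed.

Lemma digits_unique P m n m' n' :
  (m + P * n = m' + P * n' -> m < P -> m' < P -> m = m' /\ n = n')%nat.
Proof.
  intros E Hm Hm'; assert (n = n') as ->; [|lia].
  destruct (Nat.lt_total n n') as [H|[H|H]]; nia.
Qed.

Lemma Xs_list g G GL k : is_generator g G -> NoDup GL -> (forall p, In p GL <-> G p) ->
  exists l, NoDup l /\ length l = (length GL ^ S k)%nat /\ forall p, In p l <-> Xs g G k p.
Proof.
  intros HG Hnd HGL; induction k as [|k (l & H1 & H2 & H3)].
  - exists GL; simpl; split; [exact Hnd|split; [lia|exact HGL]].
  - exists (map (fun mn => (fst (fst mn) + g ^ S k * fst (snd mn),
                            snd (fst mn) + g ^ S k * snd (snd mn))%nat) (list_prod l GL)).
    split; [|split].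
    + apply NoDup_map_NoDup_ForallPairs; [|now apply NoDup_list_prod].
      intros [[m1 m2] [n1 n2]] [[m1' m2'] [n1' n2']] Hin Hin' E.
      apply in_prod_iff in Hin as [Hin _], Hin' as [Hin' _]; apply H3 in Hin, Hin'.
      apply (Xs_bound g G k _ HG) in Hin, Hin'; cbn [fst snd] in *; injection E; intros E2 E1.
      apply digits_unique in E1 as [-> ->], E2 as [-> ->]; tauto.
    + rewrite length_map, length_prod, H2, (Nat.pow_succ_r' (length GL) (S k)); lia.
    + intros p; rewrite in_map_iff; split.
      * intros ([m n] & <- & Hin); apply in_prod_iff in Hin as [Hm Hn].
        exists m, n; rewrite <- H3, <- HGL; auto.
      * intros (m & n & Hm & Hn & ->); exists (m, n); split; [reflexivity|].
        apply in_prod_iff; rewrite H3, HGL; auto.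
Qed.

Lemma dssf_box_list g G GL X k : is_generator g G -> NoDup GL -> (forall p, In p GL <-> G p) ->
  (forall p, X p <-> exists k, Xs g G k p) ->
  exists l, NoDup l /\ length l = (length GL ^ S k)%nat /\
    forall z, In z l <-> inZ X z /\ box (g ^ S k) z.
Proof.
  intros HG Hnd HGL HX; destruct (Xs_list g G GL k HG Hnd HGL) as (l & H1 & H2 & H3).
  exists (map toZ l); split; [|split].
  - apply NoDup_map_NoDup_ForallPairs; [|exact H1].
    intros [a b] [a' b'] _ _ E; unfold toZ in E; injection E; cbn; intros; f_equal; lia.
  - now rewrite length_map.
  - intros z; rewrite in_map_iff; split.
    + intros ([a b] & <- & Hin); apply H3 in Hin.
      pose proof (Xs_bound g G k _ HG Hin) as Hb.
      unfold inZ, box, toZ in *; cbn [fst snd] in *; rewrite !Nat2Z.id, HX; split; [|lia].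
      split; [lia|split; [lia|eauto]].
    + intros [(Hz1 & Hz2 & Hz) [Hb1 Hb2]].
      apply HX in Hz as [j Hj].
      exists (Z.to_nat (fst z), Z.to_nat (snd z)); split.
      * apply point_eq; unfold toZ; cbn [fst snd]; lia.
      * apply H3, (Xs_restrict g G j); [exact HG|exact Hj| |]; cbn [fst snd]; lia.
Qed.

Lemma NoDup_map_inj {A B} (f : A -> B) l x y :
  NoDup (map f l) -> In x l -> In y l -> f x = f y -> x = y.
Proof.
  induction l as [|a l IH]; simpl; [tauto|]; intros Hn.
  inversion Hn as [|? ? Ha Hn']; subst.
  intros [<-|Hx] [<-|Hy] E; auto; exfalso; apply Ha; [rewrite E|rewrite <- E];
    now apply in_map.
Qed.

(** A list of at most [g] points that projects onto [g] values projects injectively, which the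
    collision of [x] and [y] forbids. *)
Lemma length_gt_of_cover (f : nat * nat -> nat) g (GL : list (nat * nat)) x y :
  (forall i, (i < g)%nat -> exists p, In p GL /\ f p = i) ->
  In x GL -> In y GL -> x <> y -> f x = f y -> (g < length GL)%nat.
Proof.
  intros Hc Hx Hy Hxy E; apply Nat.nle_gt; intros Hl; apply Hxy.
  apply (NoDup_map_inj f GL); auto.
  apply (NoDup_incl_NoDup (l := seq 0 g)); [apply seq_NoDup|now rewrite length_map, length_seq|].
  intros i Hi; apply in_seq in Hi; destruct (Hc i) as (p & Hp & <-); [lia|now apply in_map].
Qed.

Lemma tree_fractal_growth X : tree_fractal X ->
  inZ X (0, 0) /\ ~ linear (inZ X) /\
  forall B : nat, exists M : nat, forall l, NoDup l ->
     (forall z, In z l -> inZ X z /\ box (B * M) z) -> (length l < M * M)%nat.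
Proof.
  intros [(g & Hg & G & HG & HX) (_ & Hcon & _)].
  assert (HGall := HG); destruct HGall as (HGb & HG0 & (p & Hp & Hp0) & (q & Hq1 & Hq2 & Hq) & Hrow & Hcol).
  destruct (in_decidable_list G (list_prod (seq 0 g) (seq 0 g))) as (GL & Hnd & HGL').
  { apply NoDup_list_prod; apply seq_NoDup. }
  assert (HGL : forall p, In p GL <-> G p).
  { intros [a b]; rewrite HGL', in_prod_iff, !in_seq; split; [tauto|intros Hab].
    pose proof (HGb _ Hab); simpl in *; repeat split; (lia || assumption). }
  assert (HXG : forall z, G z -> inZ X (toZ z)).
  { intros [a b] Hz; unfold inZ, toZ; cbn [fst snd]; rewrite !Nat2Z.id.
    split; [lia|split; [lia|]]; apply HX; exists O; exact Hz. }
  assert (HGX : forall a b, (a < g)%nat -> (b < g)%nat -> inZ X (toZ (a, b)) -> G (a, b)).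
  { intros a b Ha Hb (_ & _ & Hab); unfold toZ in Hab; cbn [fst snd] in Hab.
    rewrite !Nat2Z.id in Hab; apply HX in Hab as [k Hk].
    apply (Xs_restrict g G k 0 _ HG Hk); cbn [fst snd]; rewrite Nat.pow_1_r; assumption. }
  (* A path from the origin to another generator point starts at [(1, 0)] or [(0, 1)], which
     therefore lies in [G]; the row or column shared with the origin gives the collision. *)
  assert (Hlow : (g < length GL)%nat).
  { destruct (Hcon (toZ (0, 0)%nat) (toZ p)) as [l Hl]; [now apply HXG|now apply HXG|].
    destruct l as [|z l].
    - exfalso; apply Hp0; destruct p; unfold toZ in Hl; cbn in Hl; injection Hl; intros; f_equal; lia.
    - destruct Hl as (Ha & Vz & _), z as [a b].
      assert (a = 1 /\ b = 0 \/ a = 0 /\ b = 1) as [[-> ->]|[-> ->]].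
      { destruct Vz as (V1 & V2 & _); unfold adjacent, toZ in Ha; cbn [fst snd] in *; lia. }
      + apply (length_gt_of_cover snd g GL (0, 0)%nat (1, 0)%nat).
        * intros i Hi; destruct (Hrow i Hi) as [a Ha']; exists (a, i); now rewrite HGL.
        * now apply HGL.
        * apply HGL, HGX; [lia|lia|exact Vz].
        * congruence.
        * reflexivity.
      + apply (length_gt_of_cover fst g GL (0, 0)%nat (0, 1)%nat).
        * intros i Hi; destruct (Hcol i Hi) as [b Hb']; exists (i, b); now rewrite HGL.
        * now apply HGL.
        * apply HGL, HGX; [lia|lia|exact Vz].
        * congruence.
        * reflexivity. }
  assert (Hup : (length GL < g * g)%nat).
  { apply Nat.nle_gt; intros Hl; apply Hq, HGL.
    assert (Hi : incl (list_prod (seq 0 g) (seq 0 g)) GL).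
    { apply NoDup_length_incl; [exact Hnd|now rewrite length_prod, length_seq|].
      intros z Hz; now apply HGL'. }
    apply Hi; destruct q; apply in_prod_iff; rewrite !in_seq; cbn in *; lia. }
  split; [exact (HXG _ HG0)|split].
  - intros [K HK].
    (* With this [m] Bernoulli gives [N^j >= (g+1)^j >= (2*K+2) * g^j], which exceeds the linear
       bound [K * (g^j + 1)]. *)
    pose (m := (2 * K + 1)%nat); pose (j := (g * m)%nat).
    destruct (dssf_box_list g G GL X (j - 1) HG Hnd HGL HX) as (l & H1 & H2 & H3).
    replace (S (j - 1)) with j in * by (unfold j, m; nia).
    destruct (HK (g ^ j)%nat) as (l' & H4 & H5).
    assert (H6 : (length l <= length l')%nat).
    { apply NoDup_incl_length; [exact H1|]; intros z Hz; apply H3 in Hz; now apply H5. }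
    assert (H7 := bernoulli_nat g m ltac:(lia)); fold j in H7.
    assert (H8 : ((g + 1) ^ j <= length GL ^ j)%nat) by (apply Nat.pow_le_mono_l; lia).
    assert (H9 : (g ^ j <> 0)%nat) by (apply Nat.pow_nonzero; lia).
    unfold m in H7; clear - H2 H4 H6 H7 H8 H9.
    generalize dependent (g ^ j)%nat; generalize dependent ((g + 1) ^ j)%nat; intros; nia.
  - intros B.
    (* Here [N <= n], and the box of side [B * g^j] fits into side [g^(B+j)]. It has at most
       [n^(B+j) = m * n^j] points, less than [(m+1) * n^j <= (n+1)^j = (g^j)^2]; the factor [m] pays
       for enlarging the box. *)
    pose (n := (g * g - 1)%nat); pose (m := (n ^ B)%nat); pose (j := (n * m)%nat).
    assert (Hn : (1 <= n)%nat) by (unfold n; nia).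
    assert (Hm : (1 <= m)%nat) by (apply Nat.le_succ_l, Nat.neq_0_lt_0, Nat.pow_nonzero; lia).
    exists (g ^ j)%nat; intros l Hl Hin.
    destruct (dssf_box_list g G GL X (B + j - 1) HG Hnd HGL HX) as (l' & H1 & H2 & H3).
    replace (S (B + j - 1)) with (B + j)%nat in * by (unfold j; nia).
    assert (H4 : (length l <= length l')%nat).
    { apply NoDup_incl_length; [exact Hl|]; intros z Hz; apply H3.
      destruct (Hin z Hz) as [Vz Hb]; split; [exact Vz|].
      assert (HB : (B * g ^ j <= g ^ (B + j))%nat).
      { rewrite Nat.pow_add_r; apply Nat.mul_le_mono_r.
        apply Nat.lt_le_incl, Nat.pow_gt_lin_r; lia. }
      unfold box in *; lia. }
    assert (H5 : (length GL ^ (B + j) <= n ^ (B + j))%nat)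
      by (apply Nat.pow_le_mono_l; unfold n; lia).
    assert (H6 := bernoulli_nat n m Hn); fold j in H6.
    assert (H7 : ((n + 1) ^ j = g ^ j * g ^ j)%nat).
    { rewrite <- Nat.pow_mul_l; f_equal; unfold n; nia. }
    assert (H8 : (n ^ (B + j) = m * n ^ j)%nat) by apply Nat.pow_add_r.
    assert (H9 : (n ^ j <> 0)%nat) by (apply Nat.pow_nonzero; lia).
    rewrite H8 in H5; rewrite Nat.mul_add_distr_r in H6; lia.
Qed.

(** * Stability and fair assembly sequences *)

Definition link (p : point) (t : tile) (q : point) (u : tile) : nat :=
  let (x, y) := p in let (x', y') := q in
  if (x' =? x + 1) && (y' =? y) then glue_match (tE t) (tW u)
  else if (x' =? x - 1) && (y' =? y) then glue_match (tW t) (tE u)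
  else if (x' =? x) && (y' =? y + 1) then glue_match (tN t) (tS u)
  else if (x' =? x) && (y' =? y - 1) then glue_match (tS t) (tN u)
  else 0%nat.

Lemma weight_link a p q t u : a p = Some t -> a q = Some u -> weight a p q = link p t q u.
Proof. unfold weight; intros -> ->; destruct p, q; reflexivity. Qed.

Lemma glue_match_sym g h : glue_match g h = glue_match h g.
Proof.
  unfold glue_match; destruct (glue_eq_dec g h), (glue_eq_dec h g); congruence.
Qed.

Ltac eqb_cases := repeat match goal with
  | |- context [?a =? ?b] => destruct (Z.eqb_spec a b); cbn [andb]; try lia
  end.

Lemma link_sym p t q u : link p t q u = link q u p t.
Proof.
  destruct p as [x y], q as [x' y']; unfold link; eqb_cases;
    try reflexivity; apply glue_match_sym.
Qed.

Lemma link_adjacent p t q u : link p t q u <> 0%nat -> adjacent p q.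
Proof.
  destruct p as [x y], q as [x' y']; unfold link, adjacent; cbn [fst snd];
    eqb_cases; intros; try lia; congruence.
Qed.

Lemma link_translate p t q u v : link (translate p v) t (translate q v) u = link p t q u.
Proof.
  destruct p as [x y], q as [x' y']; unfold link, translate; cbn [fst snd];
    eqb_cases; reflexivity.
Qed.

Lemma weight_sym a p q : weight a p q = weight a q p.
Proof.
  destruct (a p) as [t|] eqn:Ep, (a q) as [u|] eqn:Eq.
  - rewrite (weight_link a p q t u), (weight_link a q p u t) by assumption; apply link_sym.
  - unfold weight; now rewrite Ep, Eq.
  - unfold weight; now rewrite Ep, Eq.
  - unfold weight; now rewrite Ep, Eq.
Qed.

Definition pull (a : config) (p : point) (t : tile) (q : point) : nat :=
  match a q with Some u => link p t q u | None => 0%nat end.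

Definition bind (a : config) (p : point) (t : tile) : nat :=
  list_sum (map (pull a p t) (nbrs p)).

(** The local form of adding a tile: by [stable_add] and [stable_bind] the bound on [bind] amounts
    to stability of the extension, for a stable configuration with nonempty domain. *)
Definition attachable (T : list tile) (tau : nat) (a : config) (p : point) (t : tile) : Prop :=
  In t T /\ a p = None /\ (tau <= bind a p t)%nat.

Definition sub (a b : config) : Prop := forall p t, a p = Some t -> b p = Some t.

Lemma list_sum_le {A} (f g : A -> nat) L :
  (forall x, In x L -> (f x <= g x)%nat) -> (list_sum (map f L) <= list_sum (map g L))%nat.
Proof.
  induction L as [|x L IH]; simpl; intros H; [lia|].
  assert (f x <= g x)%nat by auto; assert (list_sum (map f L) <= list_sum (map g L))%nat by auto; lia.
Qed.

Lemma list_sum_support {A} (dec : forall x y : A, {x = y} + {x <> y}) (f : A -> nat) L M :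
  NoDup L -> (forall x, In x L -> f x <> 0%nat -> In x M) ->
  (list_sum (map f L) <= list_sum (map f M))%nat.
Proof.
  revert M; induction L as [|x L IH]; intros M Hn H; [simpl; lia|].
  inversion Hn as [|? ? Hx Hn']; subst.
  destruct (Nat.eq_dec (f x) 0) as [E|E].
  - simpl; rewrite E; apply IH; [exact Hn'|]; intros y Hy; apply H; now right.
  - destruct (in_split x M) as (M1 & M2 & ->); [apply H; [now left|exact E]|].
    specialize (IH (M1 ++ M2) Hn').
    rewrite map_app, list_sum_app in *; simpl.
    assert (list_sum (map f L) <= list_sum (map f M1) + list_sum (map f M2))%nat; [|lia].
    apply IH; intros y Hy Hf.
    specialize (H y (or_intror Hy) Hf); apply in_app_iff in H; apply in_app_iff.
    destruct H as [H|[<-|H]]; tauto.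
Qed.

Lemma list_sum_pos {A} (f : A -> nat) L :
  (1 <= list_sum (map f L))%nat -> exists x, In x L /\ f x <> 0%nat.
Proof.
  induction L as [|x L IH]; simpl; [lia|]; intros H.
  destruct (Nat.eq_dec (f x) 0) as [E|E]; [|now exists x; auto].
  destruct IH as (y & ? & ?); [lia|]; exists y; auto.
Qed.

Lemma list_sum_filter {A} (f : A -> nat) P L :
  (forall x, In x L -> P x = false -> f x = 0%nat) ->
  list_sum (map f (filter P L)) = list_sum (map f L).
Proof.
  induction L as [|x L IH]; simpl; intros H; [reflexivity|].
  destruct (P x) eqn:E; simpl; rewrite IH; auto; rewrite H; auto.
Qed.

Lemma nbrs_NoDup p : NoDup (nbrs p).
Proof.
  destruct p as [x y]; unfold nbrs; repeat constructor; simpl; intros H;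
    repeat match goal with H : _ \/ _ |- _ => destruct H as [H|H] end;
    try (injection H; intros; lia); assumption.
Qed.

Lemma nbrs_translate p v : nbrs (translate p v) = map (fun q => translate q v) (nbrs p).
Proof.
  destruct p as [x y]; unfold nbrs, translate; cbn [map fst snd].
  repeat (apply f_equal2; [apply point_eq; cbn [fst snd]; lia|]); reflexivity.
Qed.

Lemma bind_mono a a' p v t :
  (forall q u, adjacent p q -> a q = Some u -> a' (translate q v) = Some u) ->
  (bind a p t <= bind a' (translate p v) t)%nat.
Proof.
  intros H; unfold bind; rewrite nbrs_translate, map_map; apply list_sum_le.
  intros q Hq; apply nbrs_spec in Hq; unfold pull.
  destruct (a q) as [u|] eqn:E; [|lia].
  rewrite (H q u Hq E), link_translate; lia.
Qed.

Lemma translate_0 p : translate p (0, 0) = p.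
Proof. apply point_eq; unfold translate; cbn [fst snd]; lia. Qed.

Lemma bind_mono0 a a' p t :
  (forall q u, adjacent p q -> a q = Some u -> a' q = Some u) ->
  (bind a p t <= bind a' p t)%nat.
Proof.
  intros H; rewrite <- (translate_0 p) at 2; apply bind_mono.
  intros q u Hq Hu; rewrite translate_0; auto.
Qed.

Lemma bind_neighbour a p t : (1 <= bind a p t)%nat -> exists q u, adjacent p q /\ a q = Some u.
Proof.
  intros H; apply list_sum_pos in H as (q & Hq & Hp); apply nbrs_spec in Hq.
  unfold pull in Hp; destruct (a q) as [u|] eqn:E; [|congruence]; eauto.
Qed.

Lemma add_tile_same a p t : add_tile a p t p = Some t.
Proof. unfold add_tile; now rewrite !Z.eqb_refl. Qed.

Lemma add_tile_other a p t q : q <> p -> add_tile a p t q = a q.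
Proof.
  intros H; unfold add_tile.
  destruct (Z.eqb_spec (fst q) (fst p)), (Z.eqb_spec (snd q) (snd p)); try reflexivity.
  exfalso; apply H, point_eq; assumption.
Qed.

Lemma add_tile_sub a p t : a p = None -> sub a (add_tile a p t).
Proof. intros H q u Hq; rewrite add_tile_other; [exact Hq|congruence]. Qed.

Lemma sub_trans a b c : sub a b -> sub b c -> sub a c.
Proof. unfold sub; auto. Qed.

Lemma sub_dom a b p : sub a b -> dom a p -> dom b p.
Proof.
  unfold dom; intros H Hp; destruct (a p) as [t|] eqn:E; [|congruence].
  rewrite (H _ _ E); congruence.
Qed.

Lemma sub_weight a b p q : sub a b -> dom a p -> dom a q -> weight b p q = weight a p q.
Proof.
  unfold dom; intros H Hp Hq.
  destruct (a p) as [t|] eqn:Ep, (a q) as [u|] eqn:Eq; try congruence.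
  rewrite (weight_link a p q t u), (weight_link b p q t u) by auto; reflexivity.
Qed.

Lemma stable_sub_cut tau a b (A : point -> Prop) :
  stable tau a -> sub a b ->
  (exists p, dom a p /\ A p) -> (exists q, dom a q /\ ~ A q) ->
  exists l : list (point * point),
    NoDup l /\
    (forall e, In e l -> dom b (fst e) /\ A (fst e) /\ dom b (snd e) /\ ~ A (snd e)) /\
    (tau <= fold_right plus 0%nat (map (fun e => weight b (fst e) (snd e)) l))%nat.
Proof.
  intros Hs Hab H1 H2; destruct (Hs A H1 H2) as (l & L1 & L2 & L3).
  exists l; split; [exact L1|split].
  - intros e He; destruct (L2 e He) as (D1 & ? & D2 & ?).
    repeat split; try assumption; now apply (sub_dom a b).
  - rewrite (map_ext_in _ (fun e => weight a (fst e) (snd e))); [exact L3|].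
    intros e He; destruct (L2 e He) as (D1 & _ & D2 & _); now apply sub_weight.
Qed.

Lemma pull_weight a p t q : a p = None -> adjacent p q ->
  weight (add_tile a p t) p q = pull a p t q.
Proof.
  intros Ha Hq; unfold pull.
  assert (E : add_tile a p t q = a q).
  { apply add_tile_other; intros ->; eapply adjacent_irrefl; eauto. }
  destruct (a q) as [u|] eqn:Eq.
  - now rewrite (weight_link _ p q t u); [|apply add_tile_same|].
  - unfold weight; now rewrite add_tile_same, E.
Qed.

(** A cut that splits the old domain is already heavy enough there. Any other cut isolates [p], and
    the bonds of [p] to its occupied neighbours cross it. *)
Lemma stable_add tau a p t :
  stable tau a -> a p = None -> (tau <= bind a p t)%nat ->
  stable tau (add_tile a p t).
Proof.
  intros Hs Hp Hb A HA HnA; pose (b := add_tile a p t); fold b in HA, HnA |- *.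
  assert (Hsub : sub a b) by now apply add_tile_sub.
  pose (occ := fun q => match a q with Some _ => true | None => false end).
  pose (N := filter occ (nbrs p)).
  assert (HN : forall q, In q N -> dom a q /\ q <> p).
  { intros q Hq; apply filter_In in Hq as [_ Hq]; unfold occ in Hq; unfold dom.
    destruct (a q) eqn:E; [|discriminate]; split; congruence. }
  assert (HNn : NoDup N) by apply NoDup_filter, nbrs_NoDup.
  assert (HNb : (tau <= list_sum (map (fun q => weight b p q) N))%nat).
  { unfold N; rewrite list_sum_filter.
    - rewrite (map_ext_in _ (pull a p t)); [exact Hb|].
      intros q Hq; apply pull_weight; [exact Hp|now apply nbrs_spec].
    - intros q Hq Ho; unfold b; rewrite pull_weight; [|exact Hp|now apply nbrs_spec].
      unfold pull, occ in *; destruct (a q); congruence. }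
  assert (Hd : forall q, dom b q -> q = p \/ dom a q).
  { intros q Hq; destruct (point_dec q p) as [->|H]; [now left|right].
    unfold dom, b in *; now rewrite add_tile_other in Hq. }
  assert (Dp : dom b p) by (unfold dom, b; rewrite add_tile_same; congruence).
  destruct (classic (exists x, dom a x /\ A x)) as [H1|H1];
    [destruct (classic (exists x, dom a x /\ ~ A x)) as [H2|H2]|].
  - now apply stable_sub_cut with a.
  - assert (Ap : ~ A p).
    { destruct HnA as (q & Dq & Aq); destruct (Hd q Dq) as [->|Dq']; [exact Aq|].
      exfalso; eauto. }
    exists (map (fun q => (q, p)) N); split; [|split].
    + apply NoDup_map_NoDup_ForallPairs; [|exact HNn]; intros x y _ _; congruence.
    + intros e He; apply in_map_iff in He as (q & <- & Hq); cbn [fst snd].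
      destruct (HN q Hq) as [Dq _]; repeat split; try assumption; try (now apply (sub_dom a b)).
      apply NNPP; intros H; apply H2; exists q; auto.
    + rewrite map_map; cbn [fst snd].
      rewrite (map_ext _ (fun q => weight b p q)); [exact HNb|intros; apply weight_sym].
  - assert (Ap : A p).
    { destruct HA as (q & Dq & Aq); destruct (Hd q Dq) as [->|Dq']; [exact Aq|].
      exfalso; eauto. }
    exists (map (fun q => (p, q)) N); split; [|split].
    + apply NoDup_map_NoDup_ForallPairs; [|exact HNn]; intros x y _ _; congruence.
    + intros e He; apply in_map_iff in He as (q & <- & Hq); cbn [fst snd].
      destruct (HN q Hq) as [Dq _]; repeat split; try assumption; try (now apply (sub_dom a b)).
      intros H; apply H1; exists q; auto.
    + rewrite map_map; cbn [fst snd]; exact HNb.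
Qed.

(** Stability is tested on the cut around [p] alone: the edges crossing it start at [p], and those
    of nonzero weight end in distinct neighbours. *)
Lemma stable_bind tau a p t x :
  dom a x -> a p = None -> stable tau (add_tile a p t) -> (tau <= bind a p t)%nat.
Proof.
  intros Dx Hp Hs.
  assert (Hxp : x <> p) by (intros ->; contradiction).
  destruct (Hs (fun q => q = p)) as (l & L1 & L2 & L3).
  - exists p; split; [|reflexivity]; unfold dom; rewrite add_tile_same; congruence.
  - exists x; split; [|exact Hxp]; unfold dom; now rewrite add_tile_other.
  - eapply Nat.le_trans; [exact L3|]; unfold bind.
    set (b := add_tile a p t) in *.
    rewrite (map_ext_in _ (fun e => (fun q => weight b p q) (snd e))).
    2:{ intros e He; destruct (L2 e He) as (_ & -> & _); reflexivity. }
    rewrite <- (map_map snd (fun q => weight b p q)).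
    rewrite <- (map_ext_in (fun q => weight b p q) (pull a p t)).
    2:{ intros q Hq; apply pull_weight; [exact Hp|now apply nbrs_spec]. }
    apply (list_sum_support point_dec).
    + apply NoDup_map_NoDup_ForallPairs; [|exact L1].
      intros [e1 e2] [f1 f2] He Hf E; cbn in E; subst f2.
      destruct (L2 _ He) as (_ & E1 & _), (L2 _ Hf) as (_ & E2 & _); cbn in *; congruence.
    + intros q Hq Hw; apply nbrs_spec.
      apply in_map_iff in Hq as (e & <- & He); destruct (L2 _ He) as (_ & _ & Dq & _).
      unfold dom in Dq; destruct (b (snd e)) as [u|] eqn:E; [|congruence].
      rewrite (weight_link b p _ t u) in Hw; [now apply link_adjacent in Hw| |exact E].
      apply add_tile_same.
Qed.

(** Otherwise the grid component of [x] would define a cut without any bond across it. *)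
Lemma stable_connected tau a : (1 <= tau)%nat -> stable tau a -> grid_connected (dom a).
Proof.
  intros Ht Hs x y Dx Dy; apply NNPP; intros Hn.
  destruct (Hs (fun z => exists l, grid_path (dom a) x l z)) as (l & L1 & L2 & L3).
  - exists x; split; [exact Dx|now exists []].
  - exists y; auto.
  - destruct (list_sum_pos (fun e => weight a (fst e) (snd e)) l) as (e & He & Hw);
      [exact (Nat.le_trans _ _ _ Ht L3)|].
    destruct (L2 e He) as (D1 & [m Hm] & D2 & Hn2); apply Hn2.
    exists (m ++ [snd e]); eapply grid_path_app; [exact Hm|]; simpl; repeat split; [|exact D2].
    unfold dom in D1, D2.
    destruct (a (fst e)) as [t|] eqn:E1, (a (snd e)) as [u|] eqn:E2; try congruence.
    rewrite (weight_link a _ _ t u E1 E2) in Hw; now apply link_adjacent in Hw.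
Qed.

(** * Reachable configurations and their fair completions *)

Inductive reach (T : list tile) (sigma : config) (tau : nat) : config -> Prop :=
| reach_seed : reach T sigma tau sigma
| reach_add a p t : reach T sigma tau a -> attachable T tau a p t ->
    reach T sigma tau (add_tile a p t).

Lemma reach_valid T sigma tau a : valid_TAS T sigma tau -> reach T sigma tau a ->
  sub sigma a /\ assembly a /\ over T a /\ finite_config a /\ stable tau a.
Proof.
  intros (Ht & Ha & Ho & Hf & Hs) H; induction H as [|a p t H IH (HT & Hp & Hb)].
  - repeat split; auto; try apply Ha; intros ? ?; auto.
  - destruct IH as (I1 & [[x Dx] I2] & I3 & [l Hl] & I5).
    assert (Hst : stable tau (add_tile a p t)) by now apply stable_add.
    assert (Hsub := add_tile_sub a p t Hp).
    split; [exact (sub_trans _ _ _ I1 Hsub)|split; [split|split; [|split]]].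
    + exists x; now apply sub_dom with a.
    + now apply stable_connected with tau.
    + intros q u Hq; destruct (point_dec q p) as [->|Hqp].
      * rewrite add_tile_same in Hq; congruence.
      * rewrite add_tile_other in Hq by exact Hqp; eauto.
    + exists (p :: l); intros q Dq; destruct (point_dec q p) as [->|Hqp]; [now left|right].
      apply Hl; unfold dom in *; now rewrite add_tile_other in Dq.
    + exact Hst.
Qed.

Definition attach_step T tau (a b : config) : Prop :=
  exists p t, attachable T tau a p t /\ b = add_tile a p t.

Definition stuck T tau (a : config) : Prop := forall p t, ~ attachable T tau a p t.

Definition code_Z (z : Z) : nat := if z <? 0 then (2 * Z.to_nat (- z) + 1)%nat else (2 * Z.to_nat z)%nat.

Definition code (p : point) : nat := Cantor.to_nat (code_Z (fst p), code_Z (snd p)).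

Lemma code_inj p q : code p = code q -> p = q.
Proof.
  intros E; apply (f_equal Cantor.of_nat) in E; unfold code in E.
  rewrite !Cantor.cancel_of_to in E; injection E; unfold code_Z.
  intros E2 E1; apply point_eq.
  - destruct (Z.ltb_spec (fst p) 0), (Z.ltb_spec (fst q) 0); lia.
  - destruct (Z.ltb_spec (snd p) 0), (Z.ltb_spec (snd q) 0); lia.
Qed.

(* Attaching at the position with the smallest code makes the sequence fair. *)
Definition greedy_step T tau (a b : config) : Prop :=
  (exists p t, attachable T tau a p t /\ b = add_tile a p t /\
     forall p' t', attachable T tau a p' t' -> (code p <= code p')%nat) \/
  (stuck T tau a /\ b = a).

Lemma least_nat (P : nat -> Prop) n : P n -> exists m, P m /\ forall k, P k -> (m <= k)%nat.
Proof.
  induction n as [n IH] using lt_wf_ind; intros Hn.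
  destruct (classic (exists k, (k < n)%nat /\ P k)) as [(k & Hk & Pk)|H].
  - eauto.
  - exists n; split; [exact Hn|]; intros k Pk; apply Nat.nlt_ge; intros Hk; eauto.
Qed.

Lemma greedy_step_exists T tau a : exists b, greedy_step T tau a b.
Proof.
  destruct (classic (stuck T tau a)) as [H|H].
  - exists a; now right.
  - assert (Hn : exists n, exists p t, attachable T tau a p t /\ code p = n).
    { apply NNPP; intros Hn; apply H; intros p t Hpt; apply Hn; eauto. }
    destruct Hn as [n Hn]; destruct (least_nat (fun n => exists p t, attachable T tau a p t /\ code p = n) n Hn)
      as (m & (p & t & Hpt & <-) & Hm).
    exists (add_tile a p t); left; exists p, t; repeat split; try apply Hpt; eauto.
Qed.

Lemma choice_fun {A B} (R : A -> B -> Prop) : (forall x, exists y, R x y) -> exists f, forall x, R x (f x).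
Proof.
  intros H; exists (fun x => proj1_sig (constructive_indefinite_description _ (H x))).
  intros x; apply proj2_sig.
Qed.

(** The continuation [F] is arbitrary so that the induction can prepend the attachment steps to it
    one at a time. *)
Lemma reach_history T sigma tau a : reach T sigma tau a ->
  forall F : nat -> config, F O = a ->
  exists s L, s O = sigma /\ (forall i, s (L + i)%nat = F i) /\
    forall i, (i < L)%nat -> attach_step T tau (s i) (s (S i)).
Proof.
  induction 1 as [|a p t H IH Hpt]; intros F HF.
  - exists F, O; repeat split; auto; intros; lia.
  - destruct (IH (fun i => match i with O => a | S i => F i end) eq_refl) as (s & L & H0 & H1 & H2).
    exists s, (S L); split; [exact H0|split].
    + intros i; rewrite <- (H1 (S i)); f_equal; lia.
    + intros i Hi; destruct (Nat.eq_dec i L) as [->|Hne]; [|apply H2; lia].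
      pose proof (H1 O) as E0; pose proof (H1 1%nat) as E1; cbn in E0, E1.
      rewrite Nat.add_0_r in E0; rewrite Nat.add_1_r in E1; rewrite E0, E1, HF.
      exists p, t; auto.
Qed.

Lemma attach_step1 T tau a b : attach_step T tau a b -> step1 a b.
Proof.
  intros (p & t & (_ & Hp & _) & ->); split; [now apply add_tile_sub|].
  exists p; split; [exact Hp|split]; [rewrite add_tile_same; congruence|].
  intros q Hq; now apply add_tile_other.
Qed.

(** A stuck configuration is repeated forever, so that finite and infinite assembly sequences are
    both total functions on [nat]. *)
Definition weak_step T tau (a b : config) : Prop :=
  attach_step T tau a b \/ (stuck T tau a /\ b = a).

Lemma weak_step_sub T tau (s : nat -> config) :
  (forall i, weak_step T tau (s i) (s (S i))) -> forall i j, (i <= j)%nat -> sub (s i) (s j).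
Proof.
  intros H i j Hij; induction Hij as [|j Hij IH]; [intros p t; auto|].
  apply (sub_trans _ _ _ IH); destruct (H j) as [(p & t & (_ & Hp & _) & ->)|[_ ->]].
  - now apply add_tile_sub.
  - intros p t; auto.
Qed.

Lemma limit_exists (s : nat -> config) : (forall i j, (i <= j)%nat -> sub (s i) (s j)) ->
  exists b : config, forall p t, b p = Some t <-> exists i, s i p = Some t.
Proof.
  intros Hm.
  destruct (choice_fun (fun p o => forall t, o = Some t <-> exists i, s i p = Some t)) as [b Hb].
  - intros p; destruct (classic (exists t i, s i p = Some t)) as [(t & i & E)|H].
    + exists (Some t); intros u; split; [intros [= <-]; eauto|].
      intros [j Ej]; destruct (Nat.le_ge_cases i j) as [Hij|Hij].
      * rewrite (Hm _ _ Hij _ _ E) in Ej; exact Ej.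
      * rewrite (Hm _ _ Hij _ _ Ej) in E; congruence.
    + exists None; intros u; split; [discriminate|]; intros [j Ej]; exfalso; eauto.
  - exists b; auto.
Qed.

Lemma limit_agrees (s : nat -> config) b L :
  (forall i j, (i <= j)%nat -> sub (s i) (s j)) ->
  (forall p t, b p = Some t <-> exists i, s i p = Some t) ->
  exists i, forall q u, In q L -> b q = Some u -> s i q = Some u.
Proof.
  intros Hm Hb; induction L as [|x L [i Hi]].
  - exists O; intros q u [].
  - destruct (b x) as [t|] eqn:E.
    + destruct (proj1 (Hb x t) E) as [j Hj]; exists (Nat.max i j).
      intros q u [<-|Hq] Eu.
      * apply (Hm j); [lia|congruence].
      * apply (Hm i); [lia|auto].
    + exists i; intros q u [<-|Hq] Eu; [congruence|auto].
Qed.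

(** The history of [a] is continued greedily. Fairness makes the limit terminal, and finite stages
    make it stable, since any two points on opposite sides of a cut are present at a common
    stage. *)
Theorem reach_completes T sigma tau a : valid_TAS T sigma tau -> reach T sigma tau a ->
  exists (s : nat -> config) b, s O = sigma /\ (exists L, s L = a) /\
    (forall i, weak_step T tau (s i) (s (S i))) /\
    (forall p t, b p = Some t <-> exists i, s i p = Some t) /\
    producible T sigma tau b /\ terminal T tau b.
Proof.
  intros Hv Ha.
  destruct (choice_fun _ (greedy_step_exists T tau)) as [next Hnext].
  pose (F := fun n => Nat.iter n next a).
  destruct (reach_history _ _ _ _ Ha F eq_refl) as (s & L & H0 & HL & Hs).
  assert (Hgreedy : forall i, (L <= i)%nat -> greedy_step T tau (s i) (s (S i))).
  { intros i Hi; replace i with (L + (i - L))%nat by lia; rewrite <- Nat.add_succ_r, !HL; apply Hnext. }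
  assert (Hweak : forall i, weak_step T tau (s i) (s (S i))).
  { intros i; destruct (Nat.lt_ge_cases i L) as [Hi|Hi]; [left; auto|].
    destruct (Hgreedy i Hi) as [(p & t & H1 & H2 & _)|H]; [left; exists p, t; auto|now right]. }
  assert (Hm := weak_step_sub T tau s Hweak).
  destruct (limit_exists s Hm) as [b Hb].
  assert (Hreach : forall i, reach T sigma tau (s i)).
  { induction i as [|i IH]; [rewrite H0; constructor|].
    destruct (Hweak i) as [(p & t & Hpt & ->)|[_ ->]]; [now constructor|exact IH]. }
  assert (Hval := fun i => reach_valid T sigma tau (s i) Hv (Hreach i)).
  exists s, b; split; [exact H0|split; [|split; [exact Hweak|split; [exact Hb|split]]]].
  - exists L; specialize (HL O); now rewrite Nat.add_0_r in HL.
  (* An assembly sequence must add a tile at each step, so the padded sequence is truncated at its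
     first stuck index, if there is one. *)
  - assert (Hcases : (exists n, stuck T tau (s n) /\ forall i, (i < n)%nat -> ~ stuck T tau (s i))
                     \/ forall i, ~ stuck T tau (s i)).
    { destruct (classic (exists n, stuck T tau (s n))) as [[n Hn]|H].
      - left; destruct (least_nat (fun n => stuck T tau (s n)) n Hn) as (m & Hm1 & Hm2); exists m; split; [exact Hm1|].
        intros i Hi Hst; specialize (Hm2 i Hst); lia.
      - right; intros i Hi; eauto. }
    assert (Hstep : forall i, ~ stuck T tau (s i) -> step1 (s i) (s (S i))).
    { intros i Hi; destruct (Hweak i) as [H|[H _]]; [now apply attach_step1 with T tau|contradiction]. }
    destruct Hcases as [(n & Hn & Hlt)|Hns].
    + exists s, (Some n); split; [split; [now rewrite H0|split]|].
      * intros i _; destruct (Hval i) as (_ & ? & ? & _ & ?); auto.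
      * intros i Hi; apply Hstep, Hlt; exact Hi.
      * assert (Hconst : forall k, s (n + k)%nat = s n).
        { induction k as [|k IH]; [now rewrite Nat.add_0_r|]; rewrite Nat.add_succ_r.
          destruct (Hweak (n + k)%nat) as [(p & t & Hpt & _)|[_ E]]; [|congruence].
          rewrite IH in Hpt; exfalso; exact (Hn p t Hpt). }
        intros p t; rewrite Hb; split; [|intros (i & _ & E); eauto].
        intros [i E]; destruct (Nat.le_ge_cases i n) as [Hi|Hi]; [exists i; auto|].
        exists n; split; [simpl; lia|]; replace i with (n + (i - n))%nat in E by lia.
        now rewrite Hconst in E.
    + exists s, None; split; [split; [now rewrite H0|split]|].
      * intros i _; destruct (Hval i) as (_ & ? & ? & _ & ?); auto.
      * intros i _; apply Hstep, Hns.
      * intros p t; rewrite Hb; split; intros [i Hi]; [exists i; split; [exact I|exact Hi]|].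
        exists i; apply Hi.
  - assert (Hsb : forall i, sub (s i) b) by (intros i p t E; apply Hb; eauto).
    assert (Hin : forall q, dom b q -> exists i, dom (s i) q).
    { intros q Dq; unfold dom in Dq; destruct (b q) as [u|] eqn:E; [|congruence].
      apply Hb in E as [i Ei]; exists i; unfold dom; congruence. }
    split.
    + intros A (p & Dp & Ap) (q & Dq & Aq).
      destruct (Hin p Dp) as [i Di], (Hin q Dq) as [j Dj].
      apply stable_sub_cut with (s (Nat.max i j)); [apply Hval|apply Hsb| |].
      * exists p; split; [|exact Ap]; apply (sub_dom (s i)); [apply Hm; lia|exact Di].
      * exists q; split; [|exact Aq]; apply (sub_dom (s j)); [apply Hm; lia|exact Dj].
    (* A tile attachable to the limit is attachable from the stage where the finitely many occupied
       neighbours of [p] are present. From then on the greedy choice only takes codes up to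
       [code p], which are finitely many, yet no position is filled twice. *)
    + intros (p & t & HT & Hp & _ & Hst).
      destruct (Hval O) as (_ & [[x Dx] _] & _).
      assert (Hbind := stable_bind tau b p t x (sub_dom _ _ _ (Hsb O) Dx) Hp Hst).
      destruct (limit_agrees s b (nbrs p) Hm Hb) as [i0 Hi0].
      assert (Hsp : forall i, s i p = None).
      { intros i; destruct (s i p) as [u|] eqn:E; [|reflexivity].
        rewrite (Hsb i p u E) in Hp; discriminate. }
      assert (Hatt : forall i, (i0 <= i)%nat -> attachable T tau (s i) p t).
      { intros i Hi; split; [exact HT|split; [apply Hsp|]].
        eapply Nat.le_trans; [exact Hbind|]; apply bind_mono0.
        intros q u Hq E; apply (Hm i0 i Hi), Hi0; [now apply nbrs_spec|exact E]. }
      destruct (choice_fun (fun i q => (Nat.max i0 L <= i)%nat ->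
        s i q = None /\ dom (s (S i)) q /\ (code q <= code p)%nat)) as [P HP].
      { intros i; destruct (Nat.le_gt_cases (Nat.max i0 L) i) as [Hi|Hi].
        - destruct (Hgreedy i ltac:(lia)) as [(q & u & Hq & E & Hmin)|[Hn _]].
          + exists q; intros _; split; [apply Hq|split].
            * rewrite E; unfold dom; rewrite add_tile_same; congruence.
            * apply (Hmin p t), Hatt; lia.
          + exfalso; apply (Hn p t), Hatt; lia.
        - exists p; lia. }
      destruct (pigeonhole (fun i => code (P i)) (seq 0 (S (code p))) (Nat.max i0 L))
        as (i & j & Hi & Hij & E).
      { intros n Hn; destruct (HP n Hn) as (_ & _ & Hc); apply in_seq; lia. }
      apply code_inj in E.
      destruct (HP i Hi) as (_ & Di & _), (HP j ltac:(lia)) as (Nj & _ & _).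
      apply (sub_dom _ (s j)) in Di; [|apply Hm; lia].
      rewrite E in Di; contradiction.
Qed.

(** * Replaying a cone inside another one *)

Definition block (c : Z) (x : point) : point := (fst x / c, snd x / c).

Definition scale (c : Z) (v : point) : point := (c * fst v, c * snd v).

Lemma block_translate c x v : 0 < c -> block c (translate x (scale c v)) = translate (block c x) v.
Proof.
  intros Hc; apply point_eq; unfold block, translate, scale; cbn [fst snd];
    rewrite (Z.mul_comm c), Z.div_add; lia.
Qed.

Lemma div_near c x y : 0 < c -> Z.abs (x - y) <= 1 -> Z.abs (x / c - y / c) <= 1.
Proof.
  intros Hc H.
  assert (y - 1 * c <= x /\ x <= y + 1 * c) as [H1 H2] by lia.
  apply (Z.div_le_mono _ _ c Hc) in H2; rewrite Z.div_add in H2 by lia.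
  assert (H3 : y <= x + 1 * c) by lia.
  apply (Z.div_le_mono _ _ c Hc) in H3; rewrite Z.div_add in H3 by lia; lia.
Qed.

Lemma block_adjacent c x y : 0 < c -> adjacent x y ->
  block c x = block c y \/ adjacent (block c x) (block c y).
Proof.
  intros Hc H; destruct (point_dec (block c x) (block c y)) as [E|E]; [now left|right].
  unfold adjacent, block in *; cbn [fst snd].
  assert (H1 := div_near c (fst x) (fst y) Hc); assert (H2 := div_near c (snd x) (snd y) Hc).
  assert (fst x = fst y \/ snd x = snd y) as [E1|E1] by lia; rewrite E1 in *.
  - assert (snd x / c <> snd y / c) by congruence; lia.
  - assert (fst x / c <> fst y / c) by congruence; lia.
Qed.

(** The configuration grows into some terminal assembly, and strict self-assembly fixes the domain
    of every one of them. *)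
Lemma reach_in_shape T sigma tau X a x :
  valid_TAS T sigma tau -> strictly_self_assembles T sigma tau X ->
  reach T sigma tau a -> dom a x -> X x.
Proof.
  intros Hv Hs Ha Dx.
  destruct (reach_completes T sigma tau a Hv Ha) as (s & b & _ & [L HL] & _ & Hb & Hp & Ht).
  apply (Hs b Hp Ht); unfold dom in *; destruct (a x) as [t|] eqn:E; [|congruence].
  rewrite (proj2 (Hb x t)); [congruence|]; exists L; now rewrite HL.
Qed.

(** A stuck stage would be final and have finite domain; as the shape is infinite, a tile is
    attached at every step. *)
Lemma full_sequence T sigma tau X :
  valid_TAS T sigma tau -> strictly_self_assembles T sigma tau X -> infinite X ->
  exists (s : nat -> config) (P : nat -> point) (u : nat -> tile) (b : config),
    s O = sigma /\
    (forall i, attachable T tau (s i) (P i) (u i) /\ s (S i) = add_tile (s i) (P i) (u i)) /\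
    (forall x t, b x = Some t <-> exists i, s i x = Some t) /\
    (forall x, dom b x <-> X x).
Proof.
  intros Hv Hs Hinf.
  destruct (reach_completes T sigma tau sigma Hv (reach_seed _ _ _))
    as (s & b & H0 & _ & Hw & Hb & Hp & Ht).
  assert (HX := Hs b Hp Ht).
  assert (Hreach : forall i, reach T sigma tau (s i)).
  { induction i as [|i IH]; [rewrite H0; constructor|].
    destruct (Hw i) as [(p & t & Hpt & ->)|[_ ->]]; [now constructor|exact IH]. }
  destruct (choice_fun (fun i pu => attachable T tau (s i) (fst pu) (snd pu) /\
      s (S i) = add_tile (s i) (fst pu) (snd pu))) as [f Hf].
  { intros i; destruct (Hw i) as [(p & t & Hpt & E)|[Hst E]]; [now exists (p, t)|].
    exfalso; apply Hinf.
    destruct (reach_valid T sigma tau (s i) Hv (Hreach i)) as (_ & _ & _ & [l Hl] & _).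
    exists l; intros z Hz; apply HX in Hz; apply Hl.
    assert (Hconst : forall k, s (i + k)%nat = s i).
    { induction k as [|k IH]; [now rewrite Nat.add_0_r|]; rewrite Nat.add_succ_r.
      destruct (Hw (i + k)%nat) as [(p & t & Hpt & _)|[_ E']]; [|congruence].
      rewrite IH in Hpt; exfalso; exact (Hst p t Hpt). }
    unfold dom in *; destruct (b z) as [t|] eqn:Ez; [|congruence].
    apply Hb in Ez as [j Ej]; destruct (Nat.le_ge_cases j i) as [Hji|Hji].
    - rewrite (weak_step_sub T tau s Hw j i Hji z t Ej); congruence.
    - replace j with (i + (j - i))%nat in Ej by lia; rewrite Hconst in Ej; congruence. }
  exists s, (fun i => fst (f i)), (fun i => snd (f i)), b; auto.
Qed.

Fixpoint words {A} (L : list A) (n : nat) : list (list A) :=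
  match n with
  | O => [[]]
  | S n => flat_map (fun w => map (fun a => a :: w) L) (words L n)
  end.

Lemma in_words {A} (L : list A) w : (forall a, In a w -> In a L) -> In w (words L (length w)).
Proof.
  induction w as [|a w IH]; simpl; intros H; [now left|].
  apply in_flat_map; exists w; split; [apply IH; auto|].
  apply (in_map (fun a => a :: w)); auto.
Qed.

(** * Window movies of a fixed assembly sequence *)

Section Pump.

Variables (T : list tile) (sigma : config) (tau : nat) (V : point -> Prop) (c : Z).
Hypothesis Hc : 0 < c.
Hypothesis Hac : ~ grid_has_cycle V.
Hypothesis Hvalid : valid_TAS T sigma tau.
Hypothesis Hself : strictly_self_assembles T sigma tau (scaling c V).

Variables (s : nat -> config) (P : nat -> point) (u : nat -> tile) (b : config).
Hypothesis Hs0 : s O = sigma.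
Hypothesis Hstep : forall i, attachable T tau (s i) (P i) (u i) /\ s (S i) = add_tile (s i) (P i) (u i).
Hypothesis Hb : forall x t, b x = Some t <-> exists i, s i x = Some t.
Hypothesis Hdom : forall x, dom b x <-> V (block c x).

Variable S0 : list point.
Hypothesis HS0 : forall x, dom sigma x -> In (block c x) S0.

Lemma seq_mono i j : (i <= j)%nat -> sub (s i) (s j).
Proof.
  apply (weak_step_sub T tau s); intros k; left; exists (P k), (u k); apply Hstep.
Qed.

Lemma seq_new i : s i (P i) = None.
Proof. apply Hstep. Qed.

Lemma seq_at i : s (S i) (P i) = Some (u i).
Proof. rewrite (proj2 (Hstep i)); apply add_tile_same. Qed.

Lemma seq_off i x : x <> P i -> s (S i) x = s i x.
Proof. intros H; rewrite (proj2 (Hstep i)); now apply add_tile_other. Qed.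

Lemma seq_b i x t : s i x = Some t -> b x = Some t.
Proof. intros H; apply Hb; eauto. Qed.

Lemma seq_V i x t : s i x = Some t -> V (block c x).
Proof. intros H; apply Hdom; unfold dom; rewrite (seq_b i x t H); congruence. Qed.

(** The index of the step that fills [x]. At seed positions and outside the shape the value is
    arbitrary; [P_time] delimits where it is meaningful. *)
Definition time (x : point) : nat := epsilon (inhabits O) (fun i => P i = x).

Lemma P_inj i j : P i = P j -> i = j.
Proof.
  assert (H : forall i j, (i < j)%nat -> P i <> P j).
  { intros k l Hkl E; assert (X := seq_mono (S k) l Hkl _ _ (seq_at k)).
    rewrite E, seq_new in X; discriminate. }
  intros E; destruct (Nat.lt_total i j) as [Hij|[Hij|Hij]]; [|exact Hij|].
  - now apply H in E.
  - symmetry in E; now apply H in E.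
Qed.

Lemma time_P i : time (P i) = i.
Proof. apply P_inj, (epsilon_spec (inhabits O) (fun k => P k = P i)); eauto. Qed.

Lemma P_time x : V (block c x) -> ~ In (block c x) S0 -> P (time x) = x.
Proof.
  intros Vx Hx; apply (epsilon_spec (inhabits O) (fun k => P k = x)).
  apply Hdom in Vx; unfold dom in Vx; destruct (b x) as [t|] eqn:E; [|congruence].
  apply Hb in E as [i Ei]; clear Vx; induction i as [|i IH].
  - exfalso; apply Hx, HS0; unfold dom; rewrite Hs0 in Ei; congruence.
  - destruct (point_dec x (P i)) as [->|H]; [eauto|].
    rewrite seq_off in Ei by exact H; auto.
Qed.

(** The tile at [x] appears in passing from stage [time x] to the next one, hence the non-strict
    inequality. *)
Lemma seq_none i x : V (block c x) -> ~ In (block c x) S0 -> (s i x = None <-> (i <= time x)%nat).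
Proof.
  intros Vx Hx; assert (E := P_time x Vx Hx); split; intros H.
  - apply Nat.nlt_ge; intros Hi.
    assert (X := seq_mono (S (time x)) i Hi _ _ (seq_at (time x))); congruence.
  - destruct (s i x) as [t|] eqn:Et; [|reflexivity].
    assert (X := seq_mono i _ H _ _ Et); rewrite <- E in X at 2; now rewrite seq_new in X.
Qed.

Definition offsets : list point :=
  map toZ (list_prod (seq 0 (Z.to_nat c)) (seq 0 (Z.to_nat c))).

Definition window (p q : point) : list point :=
  map (translate (scale c p)) offsets ++ map (translate (scale c q)) offsets.

(* The window movie of the edge from [p] to [q]; the order of arrival of its tiles is
   recorded as a comparison matrix, so that movies of different windows can be compared
   without mentioning positions. *)
Definition movie (p q : point) : point * list (option tile) * list (list bool) :=
  (diff q p, map b (window p q),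
   map (fun x => map (fun y => time x <? time y)%nat (window p q)) (window p q)).

Lemma in_window p q x : block c x = p \/ block c x = q -> In x (window p q).
Proof.
  assert (H : forall r, block c x = r -> In x (map (translate (scale c r)) offsets)).
  { intros r <-; apply in_map_iff; exists (fst x mod c, snd x mod c); split.
    - apply point_eq; unfold translate, scale, block; cbn [fst snd]; rewrite <- Z.div_mod; lia.
    - unfold offsets; apply in_map_iff.
      exists (Z.to_nat (fst x mod c), Z.to_nat (snd x mod c)).
      pose proof (Z.mod_pos_bound (fst x) c Hc); pose proof (Z.mod_pos_bound (snd x) c Hc).
      split; [apply point_eq; unfold toZ; cbn [fst snd]; lia|].
      apply in_prod; apply in_seq; lia. }
  intros [E|E]; apply in_or_app; [left|right]; auto.
Qed.

Lemma window_translate p q d :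
  window (translate p d) (translate q d) = map (fun x => translate x (scale c d)) (window p q).
Proof.
  assert (H : forall r, map (translate (scale c (translate r d))) offsets =
     map (fun x => translate x (scale c d)) (map (translate (scale c r)) offsets)).
  { intros r; rewrite map_map; apply map_ext; intros x; apply point_eq;
      unfold translate, scale; cbn [fst snd]; lia. }
  unfold window; rewrite map_app, !H; reflexivity.
Qed.

(** Equal directions make the edges translates of each other, so the two windows are listed in
    matching order and the recorded data can be compared entry by entry. *)
Lemma movie_eq p1 q1 p2 q2 : movie p1 q1 = movie p2 q2 ->
  p2 = translate p1 (diff q2 q1) /\
  forall x y, block c x = p1 \/ block c x = q1 -> block c y = p1 \/ block c y = q1 ->
    b (translate x (scale c (diff q2 q1))) = b x /\
    ((time x < time y)%nat <->
     (time (translate x (scale c (diff q2 q1))) < time (translate y (scale c (diff q2 q1))))%nat).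
Proof.
  unfold movie; intros E; injection E; intros E3 E2 E1b E1a.
  assert (Ep : p2 = translate p1 (diff q2 q1)).
  { apply point_eq; unfold translate, diff in *; cbn [fst snd] in *; lia. }
  split; [exact Ep|]; set (d := diff q2 q1) in *.
  assert (Eq : q2 = translate q1 d).
  { apply point_eq; unfold d, translate, diff; cbn [fst snd]; lia. }
  assert (EW : window p2 q2 = map (fun x => translate x (scale c d)) (window p1 q1)).
  { rewrite Ep at 1; rewrite Eq at 1; apply window_translate. }
  rewrite EW, !map_map in E2, E3.
  intros x y Hx Hy; apply in_window in Hx, Hy; split.
  - symmetry; exact (ext_in_map E2 _ Hx).
  - assert (E4 := ext_in_map E3 _ Hx); cbn beta in E4; rewrite map_map in E4.
    assert (E5 := ext_in_map E4 _ Hy); cbn beta in E5.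
    rewrite <- !Nat.ltb_lt, E5; reflexivity.
Qed.

(** * Splicing two cones with equal movies *)

Section Replace.

Variables p1 q1 p2 q2 : point.
Hypothesis G1 : good V S0 p1 q1.
Hypothesis G2 : good V S0 p2 q2.
Hypothesis HM : movie p1 q1 = movie p2 q2.

Let d := diff q2 q1.
Let v := scale c d.
Let K1 x := cone V p1 q1 (block c x).
Let K2 x := cone V p2 q2 (block c x).
Let W1 x := block c x = p1 \/ block c x = q1.

Lemma block_v x : block c (translate x v) = translate (block c x) d.
Proof. apply block_translate, Hc. Qed.

Lemma translate_back x : translate (diff x v) v = x.
Proof. apply point_eq; unfold translate, diff; cbn [fst snd]; lia. Qed.

Lemma translate_inj x y w : translate x w = translate y w <-> x = y.
Proof.
  split; [|congruence]; unfold translate; intros H; apply point_eq.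
  - apply (f_equal fst) in H; cbn [fst] in H; lia.
  - apply (f_equal snd) in H; cbn [snd] in H; lia.
Qed.

Lemma block_p x : block c (translate x v) = p2 <-> block c x = p1.
Proof.
  destruct (movie_eq _ _ _ _ HM) as [E _]; fold d in E; rewrite block_v, E.
  apply translate_inj.
Qed.

Lemma block_q x : block c (translate x v) = q2 <-> block c x = q1.
Proof.
  assert (E : q2 = translate q1 d).
  { apply point_eq; unfold d, translate, diff; cbn [fst snd]; lia. }
  rewrite block_v, E at 1; apply translate_inj.
Qed.

Lemma window_free x : W1 x -> V (block c x) /\ ~ In (block c x) S0.
Proof.
  destruct G1 as (Vp & Vq & _ & Hp & Hq).
  intros [->| ->]; split; auto; apply Hq, cone_self.
Qed.

Lemma K1_V x : K1 x -> V (block c x) /\ ~ In (block c x) S0.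
Proof.
  destruct G1 as (Vp & Vq & _ & Hp & Hq); intros H; split; [|now apply Hq].
  exact (cone_sub V _ _ _ Vq H).
Qed.

Lemma K2_V x : K2 x -> V (block c x) /\ ~ In (block c x) S0.
Proof.
  destruct G2 as (Vp & Vq & _ & Hp & Hq); intros H; split; [|now apply Hq].
  exact (cone_sub V _ _ _ Vq H).
Qed.

Lemma crossing p q x y : good V S0 p q -> adjacent x y -> cone V p q (block c x) ->
  V (block c y) -> ~ cone V p q (block c y) -> block c x = q /\ block c y = p.
Proof.
  intros (Vp & Vq & Ha & _) Hxy Hx Vy Hy.
  destruct (block_adjacent c x y Hc Hxy) as [E|E]; [rewrite E in Hx; contradiction|].
  now apply cone_boundary with V.
Qed.

Lemma p1_not_K1 x : block c x = p1 -> ~ K1 x.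
Proof.
  destruct G1 as (_ & _ & Ha & _); intros E; unfold K1; rewrite E.
  now apply cone_not_root, adjacent_neq.
Qed.

Lemma p2_not_K2 x : block c x = p2 -> ~ K2 x.
Proof.
  destruct G2 as (_ & _ & Ha & _); intros E; unfold K2; rewrite E.
  now apply cone_not_root, adjacent_neq.
Qed.

Lemma q1_K1 x : block c x = q1 -> K1 x.
Proof. unfold K1; intros ->; apply cone_self. Qed.

Lemma q2_K2 x : block c x = q2 -> K2 x.
Proof. unfold K2; intros ->; apply cone_self. Qed.

(** Clock [i] runs outside the first cone, clock [j] inside the second, whose content is pulled back
    by [v]. The cones are not yet known to be translates, so positions of the first without a
    counterpart in the second stay empty. *)
Definition spliced (i j : nat) : config := fun x =>
  if excluded_middle_informative (K1 x) then
    if excluded_middle_informative (K2 (translate x v)) then s j (translate x v) else None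
  else s i x.

Lemma spliced_in i j x : K1 x -> K2 (translate x v) -> spliced i j x = s j (translate x v).
Proof.
  unfold spliced; destruct (excluded_middle_informative (K1 x)),
    (excluded_middle_informative (K2 (translate x v))); tauto.
Qed.

Lemma spliced_out i j x : ~ K1 x -> spliced i j x = s i x.
Proof. unfold spliced; destruct (excluded_middle_informative (K1 x)); tauto. Qed.

Definition synced (i j : nat) : Prop := forall x, W1 x -> s i x = s j (translate x v).

(** No tile of the second cone is lost in the splice up to time [j]. Over all [j] this becomes the
    inclusion of cones that is wanted. *)
Definition fits (j : nat) : Prop :=
  forall x, K2 x -> dom (s j) x -> K1 (diff x v).

Lemma spliced_step_out i j : ~ K1 (P i) ->
  spliced (S i) j = add_tile (spliced i j) (P i) (u i).
Proof.
  intros Hk; extensionality x; destruct (point_dec x (P i)) as [->|Hx].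
  - now rewrite add_tile_same, spliced_out, seq_at.
  - rewrite add_tile_other by exact Hx; unfold spliced; now rewrite (seq_off i x Hx).
Qed.

Lemma spliced_skip_out i j : K1 (P i) -> spliced (S i) j = spliced i j.
Proof.
  intros Hk; extensionality x; unfold spliced.
  destruct (excluded_middle_informative (K1 x)) as [H|H]; [reflexivity|].
  apply seq_off; intros ->; contradiction.
Qed.

Lemma spliced_step_in i j x : P j = translate x v -> K2 (P j) -> K1 x ->
  spliced i (S j) = add_tile (spliced i j) x (u j).
Proof.
  intros E Hk Hx; extensionality y; destruct (point_dec y x) as [->|Hy].
  - rewrite add_tile_same, spliced_in, <- E; [apply seq_at|exact Hx|now rewrite <- E].
  - rewrite add_tile_other by exact Hy; unfold spliced.
    rewrite (seq_off j (translate y v)); [reflexivity|].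
    rewrite E; intros H; now apply Hy, (translate_inj y x v).
Qed.

Lemma spliced_skip_in i j : ~ K2 (P j) -> spliced i (S j) = spliced i j.
Proof.
  intros Hk; extensionality y; unfold spliced.
  destruct (excluded_middle_informative (K1 y)) as [_|_]; [|reflexivity].
  destruct (excluded_middle_informative (K2 (translate y v))) as [H|_]; [|reflexivity].
  apply seq_off; intros E; rewrite E in H; contradiction.
Qed.

Lemma synced_skip_l i j : synced i j -> ~ W1 (P i) -> synced (S i) j.
Proof. intros H Hw x Hx; rewrite seq_off; [auto|]; intros ->; contradiction. Qed.

Lemma synced_skip_r i j : synced i j -> ~ (block c (P j) = p2 \/ block c (P j) = q2) ->
  synced i (S j).
Proof.
  intros H Hw x Hx; rewrite (seq_off j); [auto|]; intros E; apply Hw.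
  rewrite <- E, block_p, block_q; exact Hx.
Qed.

(** A neighbour inside the first cone can only be seen across the edge from [p1] to [q1], and there
    synchronisation shows the same tile. *)
Lemma bind_out i j : synced i j -> ~ K1 (P i) ->
  (bind (s i) (P i) (u i) <= bind (spliced i j) (P i) (u i))%nat.
Proof.
  intros Hs Hk; apply bind_mono0; intros q t Hq Ht.
  destruct (classic (K1 q)) as [Kq|Kq]; [|now rewrite spliced_out].
  assert (VP : V (block c (P i))) by (apply (seq_V (S i) _ (u i)), seq_at).
  destruct (crossing p1 q1 q (P i) G1 (adjacent_sym _ _ Hq) Kq VP Hk) as [Eq Ep].
  rewrite spliced_in; [|exact Kq|apply q2_K2, block_q, Eq].
  rewrite <- Hs; [exact Ht|now right].
Qed.

(** Neighbours in the second cone are present in the copy by [fits]; a neighbour outside it lies in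
    block [p2], where synchronisation provides it. *)
Lemma bind_in i j x : synced i j -> fits j -> P j = translate x v -> K2 (P j) ->
  (bind (s j) (P j) (u j) <= bind (spliced i j) x (u j))%nat.
Proof.
  intros Hs Hf E Hk.
  assert (Ex : x = translate (P j) (diff (0, 0) v)).
  { rewrite E; apply point_eq; unfold translate, diff; cbn [fst snd]; lia. }
  rewrite Ex at 1; apply bind_mono; intros q t Hq Ht.
  assert (Eq : translate q (diff (0, 0) v) = diff q v).
  { apply point_eq; unfold translate, diff; cbn [fst snd]; lia. }
  rewrite Eq; destruct (classic (K2 q)) as [Kq|Kq].
  - rewrite spliced_in; rewrite ?translate_back; auto.
    apply Hf; [exact Kq|]; unfold dom; congruence.
  - destruct (crossing p2 q2 (P j) q G2 Hq Hk (seq_V j q t Ht) Kq) as [_ Ep].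
    rewrite <- (translate_back q) in Ep; apply (block_p (diff q v)) in Ep.
    rewrite spliced_out by now apply p1_not_K1.
    rewrite Hs, translate_back; [exact Ht|now left].
Qed.

(** The outer clock can run up to [time x] without touching the window: an earlier window tile
    would, by the common order of arrival, have its counterpart present before step [j], whereas
    synchronisation shows that place empty. Steps inside the first cone are skipped. *)
Lemma advance i j x : reach T sigma tau (spliced i j) -> synced i j ->
  W1 x -> P j = translate x v ->
  (i <= time x)%nat /\ reach T sigma tau (spliced (time x) j) /\ synced (time x) j.
Proof.
  intros Hr Hs Hx E; destruct (window_free x Hx) as [Vx Fx].
  assert (Hi : (i <= time x)%nat).
  { apply seq_none; auto; rewrite Hs, <- E by exact Hx; apply seq_new. }
  split; [exact Hi|].
  assert (H : forall k, (i + k <= time x)%nat ->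
    reach T sigma tau (spliced (i + k) j) /\ synced (i + k) j).
  { induction k as [|k IH]; intros Hk; [now rewrite Nat.add_0_r|].
    destruct IH as [IHr IHs]; [lia|]; rewrite Nat.add_succ_r; set (m := (i + k)%nat) in *.
    assert (Hw : ~ W1 (P m)).
    { intros Hw; destruct (movie_eq _ _ _ _ HM) as [_ Ho].
      destruct (Ho (P m) x Hw Hx) as [_ Ht]; fold d in Ht; fold v in Ht.
      rewrite time_P, <- E, time_P in Ht.
      assert (HN : s j (translate (P m) v) = None) by (rewrite <- IHs by exact Hw; apply seq_new).
      assert (Hlt := proj1 Ht ltac:(lia)).
      assert (V2 : V (block c (translate (P m) v)) /\ ~ In (block c (translate (P m) v)) S0).
      { destruct Hw as [Hw|Hw].
        - apply block_p in Hw; rewrite Hw; destruct G2 as (? & _ & _ & ? & _); auto.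
        - apply K2_V, q2_K2, block_q, Hw. }
      apply seq_none in HN; [lia|apply V2|apply V2]. }
    split; [|now apply synced_skip_l].
    destruct (classic (K1 (P m))) as [Hk1|Hk1]; [now rewrite spliced_skip_out|].
    rewrite spliced_step_out by exact Hk1; constructor; [exact IHr|].
    destruct (Hstep m) as [(A1 & A2 & A3) _]; split; [exact A1|split].
    - now rewrite spliced_out.
    - eapply Nat.le_trans; [exact A3|now apply bind_out]. }
  replace (time x) with (i + (time x - i))%nat by lia; apply H; lia.
Qed.

Lemma movie_tile x j : W1 x -> P j = translate x v -> u (time x) = u j.
Proof.
  intros Hx E; destruct (window_free x Hx) as [Vx Fx].
  destruct (movie_eq _ _ _ _ HM) as [_ Ho]; destruct (Ho x x Hx Hx) as [Et _].
  fold d in Et; fold v in Et; rewrite <- E, (seq_b _ _ _ (seq_at j)) in Et.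
  assert (Ht := seq_b _ _ _ (seq_at (time x))); rewrite P_time in Ht by assumption; congruence.
Qed.

(* Step [j] inside the second cone is replayed in the first one, after the outer sequence
   has been advanced to the same point of the common movie. A replayed tile that left the
   first cone would be attached outside the shape, since the only way out of the cone
   within the shape is through the block [p1]. *)
Lemma spliced_progress j :
  fits j /\ exists i, reach T sigma tau (spliced i j) /\ synced i j.
Proof.
  induction j as [|j (Hf & i & Hr & Hs)].
  - assert (Hseed : forall x, V (block c x) /\ ~ In (block c x) S0 -> s O x = None).
    { intros x [Vx Fx]; apply seq_none; auto; lia. }
    split.
    + intros x Kx Dx; exfalso; apply Dx, Hseed, K2_V, Kx.
    + exists O; split.
      * replace (spliced 0 0) with sigma; [constructor|].
        extensionality x; rewrite <- Hs0; unfold spliced.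
        destruct (excluded_middle_informative (K1 x)) as [H|_]; [|reflexivity].
        rewrite (Hseed x (K1_V x H)).
        destruct (excluded_middle_informative (K2 (translate x v))) as [H2|_]; [|reflexivity].
        now rewrite (Hseed _ (K2_V _ H2)).
      * intros x Hx; rewrite (Hseed x (window_free x Hx)); symmetry; apply Hseed.
        destruct Hx as [Hx|Hx].
        -- apply block_p in Hx; rewrite Hx; destruct G2 as (? & _ & _ & ? & _); auto.
        -- apply K2_V, q2_K2, block_q, Hx.
  - destruct (Hstep j) as [(A1 & A2 & A3) _].
    pose (x := diff (P j) v).
    assert (E : P j = translate x v) by (symmetry; apply translate_back).
    assert (Hfits : (K2 (P j) -> K1 x) -> fits (S j)).
    { intros Hk y Ky Dy; destruct (point_dec y (P j)) as [->|Hy]; [auto|].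
      apply Hf; [exact Ky|]; unfold dom in *; now rewrite seq_off in Dy. }
    destruct (classic (block c (P j) = p2 \/ block c (P j) = q2)) as [Hw|Hw].
    + assert (Hx : W1 x).
      { unfold W1; rewrite <- block_p, <- block_q, <- E; exact Hw. }
      destruct (window_free x Hx) as [Vx Fx].
      destruct (advance i j x Hr Hs Hx E) as (_ & Hr' & Hs'); clear i Hr Hs.
      assert (Et := movie_tile x j Hx E); assert (Ep := P_time x Vx Fx).
      set (i := time x) in *.
      assert (Hs2 : synced (S i) (S j)).
      { intros z Hz; destruct (point_dec z x) as [->|Hzx].
        - rewrite <- E, seq_at, <- Ep, seq_at; congruence.
        - rewrite !seq_off; [auto| |congruence].
          rewrite E; intros H; now apply Hzx, (translate_inj z x v). }
      destruct Hw as [Hw|Hw].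
      (* In block [p2] the tile belongs to the outside: the outer clock attaches its counterpart in
         [p1], and the inner clock merely ticks. *)
      * assert (Hk2 := p2_not_K2 _ Hw).
        split; [apply Hfits; contradiction|]; exists (S i); split; [|exact Hs2].
        rewrite E, block_p in Hw; assert (Hk1 := p1_not_K1 _ Hw).
        rewrite spliced_skip_in, spliced_step_out by (rewrite ?Ep; assumption).
        destruct (Hstep i) as [(B1 & B2 & B3) _].
        constructor; [exact Hr'|]; split; [exact B1|split].
        -- now rewrite spliced_out by now rewrite Ep.
        -- eapply Nat.le_trans; [exact B3|]; apply bind_out; [exact Hs'|now rewrite Ep].
      (* In block [q2] the roles are exchanged: the inner clock attaches the tile, and the outer
         clock passes over the same tile. *)
      * assert (Hk2 := q2_K2 _ Hw).
        assert (Hk1 : K1 x) by (apply q1_K1, block_q; now rewrite <- E).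
        split; [apply Hfits; auto|]; exists (S i); split; [|exact Hs2].
        rewrite spliced_skip_out by now rewrite Ep.
        rewrite (spliced_step_in i j x E Hk2 Hk1).
        constructor; [exact Hr'|]; split; [exact A1|split].
        -- now rewrite spliced_in, <- E by (rewrite <- ?E; assumption).
        -- eapply Nat.le_trans; [exact A3|now apply bind_in].
    + destruct (classic (K2 (P j))) as [Hk2|Hk2].
      * assert (Hbind : (tau <= bind (spliced i j) x (u j))%nat)
          by (eapply Nat.le_trans; [exact A3|now apply bind_in]).
        assert (Hk1 : K1 x).
        { apply NNPP; intros Hk1.
          assert (Hnew : spliced i j x = None -> V (block c x)).
          { intros HN; apply (reach_in_shape T sigma tau (scaling c V)
              (add_tile (spliced i j) x (u j)) x Hvalid Hself).
            - constructor; [exact Hr|]; split; [exact A1|auto].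
            - unfold dom; rewrite add_tile_same; congruence. }
          (* Either [x] is already occupied outside the first cone, hence in the shape, or the tile
             attaches there and the extended configuration is reachable. *)
          assert (Vx : V (block c x)).
          { destruct (s i x) as [t|] eqn:Ei; [now apply (seq_V i x t)|].
            apply Hnew; now rewrite spliced_out. }
          destruct (bind_neighbour (s j) (P j) (u j)) as (q & t & Hq & Ht).
          { destruct Hvalid as [Ht _]; lia. }
          assert (Kq : K2 q).
          { apply NNPP; intros Kq; apply Hw; right.
            exact (proj1 (crossing p2 q2 (P j) q G2 Hq Hk2 (seq_V j q t Ht) Kq)). }
          assert (Kq1 : K1 (diff q v)) by (apply Hf; [exact Kq|unfold dom; congruence]).
          apply Hw; left; rewrite E; apply block_p.
          refine (proj2 (crossing p1 q1 (diff q v) x G1 _ Kq1 Vx Hk1)).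
          apply adjacent_sym; unfold x, adjacent, diff in *; cbn [fst snd] in *; lia. }
        split; [apply Hfits; auto|]; exists i; split; [|now apply synced_skip_r].
        rewrite (spliced_step_in i j x E Hk2 Hk1).
        constructor; [exact Hr|]; split; [exact A1|split; [|exact Hbind]].
        now rewrite spliced_in, <- E by (rewrite <- ?E; assumption).
      * split; [apply Hfits; contradiction|]; exists i.
        rewrite spliced_skip_in by exact Hk2; split; [exact Hr|now apply synced_skip_r].
Qed.

(** One cell per block suffices: the corner of block [z] is filled at some stage [j], and [fits j]
    places its copy in the first cone. *)
Lemma cone_replaced z : cone V p2 q2 z -> cone V p1 q1 (diff z d).
Proof.
  intros Hz; pose (x := scale c z).
  assert (Ex : block c x = z).
  { apply point_eq; unfold x, block, scale; cbn [fst snd]; rewrite Z.mul_comm, Z.div_mul; lia. }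
  assert (Kx : K2 x) by (unfold K2; now rewrite Ex).
  destruct (K2_V x Kx) as [Vx _]; apply Hdom in Vx; unfold dom in Vx.
  destruct (b x) as [t|] eqn:Et; [|congruence]; apply Hb in Et as [j Ej].
  destruct (spliced_progress j) as [Hf _].
  assert (Kd : K1 (diff x v)) by (apply Hf; [exact Kx|unfold dom; congruence]).
  unfold K1 in Kd.
  assert (E : block c (diff x v) = diff z d); [|now rewrite <- E].
  apply (translate_inj _ _ d); rewrite <- block_v, translate_back, Ex.
  apply point_eq; unfold translate, diff; cbn [fst snd]; lia.
Qed.

End Replace.

Lemma cone_translate p1 q1 p2 q2 : good V S0 p1 q1 -> good V S0 p2 q2 ->
  movie p1 q1 = movie p2 q2 ->
  forall z, cone V p1 q1 z <-> cone V p2 q2 (translate z (diff q2 q1)).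
Proof.
  intros G1 G2 HM z; split; intros Hz.
  - apply (cone_replaced p2 q2 p1 q1 G2 G1 (eq_sym HM)) in Hz.
    replace (translate z (diff q2 q1)) with (diff z (diff q1 q2)); [exact Hz|].
    apply point_eq; unfold translate, diff; cbn [fst snd]; lia.
  - apply (cone_replaced p1 q1 p2 q2 G1 G2 HM) in Hz.
    replace z with (diff (translate z (diff q2 q1)) (diff q2 q1)); [exact Hz|].
    apply point_eq; unfold translate, diff; cbn [fst snd]; lia.
Qed.

(** All windows have the same number of cells, so a movie consists of one of four directions, a word
    over the tiles and a Boolean matrix, both of fixed size. *)
Lemma movies_finite : exists L, forall p q, good V S0 p q -> In (movie p q) L.
Proof.
  pose (n := length (window (0, 0) (0, 0))).
  assert (Hn : forall p q, length (window p q) = n).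
  { intros p q; unfold n, window; now rewrite !length_app, !length_map. }
  exists (list_prod (list_prod (nbrs (0, 0)) (words (None :: map Some T) n))
                    (words (words [true; false] n) n)).
  intros p q (Vp & Vq & Ha & _); unfold movie; repeat apply in_prod.
  - apply nbrs_spec; unfold adjacent, diff in *; cbn [fst snd]; lia.
  - rewrite <- (Hn p q), <- (length_map b (window p q)); apply in_words.
    intros o Ho; apply in_map_iff in Ho as (x & <- & _).
    destruct (b x) as [t|] eqn:E; [right|now left]; apply in_map.
    apply Hb in E as [i Ei].
    assert (Hr : reach T sigma tau (s i)).
    { clear Ei; induction i as [|i IH]; [rewrite Hs0; constructor|].
      rewrite (proj2 (Hstep i)); constructor; [exact IH|apply Hstep]. }
    destruct (reach_valid _ _ _ _ Hvalid Hr) as (_ & _ & Ho & _); exact (Ho x t Ei).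
  - set (f := fun x => map (fun y => (time x <? time y)%nat) (window p q)).
    rewrite <- (Hn p q) at 2; rewrite <- (length_map f (window p q)); apply in_words.
    intros w Hw; apply in_map_iff in Hw as (x & <- & _).
    rewrite <- (Hn p q); unfold f.
    rewrite <- (length_map (fun y => (time x <? time y)%nat) (window p q)).
    apply in_words; intros [] _; simpl; tauto.
Qed.

End Pump.

Theorem mainTheorem1 :
  forall (X : nat * nat -> Prop) (c : Z),
    tree_fractal X -> (0 < c)%Z ->
    ~ exists (T : list tile) (sigma : config) (tau : nat),
        valid_TAS T sigma tau /\
        strictly_self_assembles T sigma tau (scaling c (inZ X)).
Proof.
  intros X c HX Hc (T & sigma & tau & Hv & Hself).
  destruct (tree_fractal_growth X HX) as (V0 & Hnl & Hq).
  destruct HX as (_ & _ & Hcon & Hac); set (V := inZ X) in *.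
  assert (Hpos : forall z, V z -> 0 <= fst z /\ 0 <= snd z).
  { intros z (H1 & H2 & _); auto. }
  (* Every vertex of the tree is the block of a cell of the shape; a finite shape would bound the
     tree, contradicting its nonlinear growth. *)
  assert (Hinf : infinite (scaling c V)).
  { intros [l Hl]; apply Hnl; exists (length l); intros n.
    exists (map (block c) l); split; [rewrite length_map; nia|].
    intros z Vz _; apply in_map_iff; exists (scale c z).
    assert (E : block c (scale c z) = z).
    { apply point_eq; unfold block, scale; cbn [fst snd]; rewrite Z.mul_comm, Z.div_mul; lia. }
    split; [exact E|]; apply Hl; unfold scaling; fold (block c (scale c z)); now rewrite E. }
  destruct (full_sequence T sigma tau (scaling c V) Hv Hself Hinf)
    as (s & P & u & b & Hs0 & Hstep & Hb & Hdom).
  assert (Hfin := Hv); destruct Hfin as (_ & _ & _ & [ls Hls] & _).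
  pose (S0 := map (block c) ls).
  assert (HS0 : forall x, dom sigma x -> In (block c x) S0) by (intros x Hx; apply in_map; auto).
  destruct (movies_finite T sigma tau V c Hv s P u b Hs0 Hstep Hb S0) as [L HL].
  apply (finite_cone_types_absurd V S0 (movie c P b) L (0, 0)); auto.
  intros p q p' q' G1 G2 E.
  apply (cone_translate T sigma tau V c Hc Hac Hv Hself s P u b Hs0 Hstep Hb Hdom S0 HS0); auto.
Qed.
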